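(* Let $X$ be a Polish space, $Y$ a separable metrizable space, and $f:X\to Y$ any function. Then: (i) $f^{-1}(A)\in{\bf\Sigma}^0_3(X)$ for every ${\bf\Sigma}^0_2$ set $A\subseteq Y$ if and only if $f\in{\rm dec}({\bf\Sigma}^0_2,{\bf\Delta}^0_3)$; (ii) $f^{-1}(A)\in{\bf\Sigma}^0_3(X)$ for every ${\bf\Sigma}^0_3$ set $A\subseteq Y$ if and only if $f\in{\rm dec}({\bf\Sigma}^0_1,{\bf\Delta}^0_3)$.
   Context: For a separable metrizable space $Z$ and a function $g:Z\to Y$, $g$ is ${\bf\Sigma}^0_\gamma$-measurable if $g^{-1}(U)$ is ${\bf\Sigma}^0_\gamma$ in $Z$ for every open $U\subseteq Y$. We write $g\in{\rm dec}({\bf\Sigma}^0_\gamma,{\bf\Delta}^0_\delta)$ if there is a partition $(Z_k)_{k<\omega}$ of $Z$ into countably many ${\bf\Delta}^0_\delta$ subsets of $Z$ such that each restriction $g\upharpoonright Z_k$ is ${\bf\Sigma}^0_\gamma$-measurable (with $Z_k$ carrying the subspace topology). *)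

(* Defs.v *)
From HB Require Import structures.
From mathcomp Require Import all_boot all_order all_algebra.
From mathcomp Require Import boolp classical_sets functions cardinality.
From mathcomp Require Import reals topology.

Set Implicit Arguments.
Unset Strict Implicit.
Unset Printing Implicit Defensive.

Import Order.TTheory GRing.Theory Num.Theory.

Local Open Scope classical_set_scope.
Local Open Scope ring_scope.

Definition separable (T : topologicalType) : Prop :=
  exists2 D : set T, countable D & dense D.

Definition is_metric (R : realType) (T : Type) (d : T -> T -> R) : Prop :=
  [/\ forall x y, 0 <= d x y,
      forall x y, d x y = 0 <-> x = y,
      forall x y, d x y = d y x &
      forall x y z, d x z <= d x y + d y z].

Definition compatible_metric (R : realType) (T : topologicalType)
    (d : T -> T -> R) : Prop :=
  is_metric d /\
  forall A : set T, open A <->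
    forall x, A x -> exists2 e : R, 0 < e & [set y | d x y < e] `<=` A.

Definition complete_metric (R : realType) (T : topologicalType)
    (d : T -> T -> R) : Prop :=
  forall u : nat -> T,
    (forall e : R, 0 < e -> exists N : nat, forall m n : nat,
       (N <= m)%N -> (N <= n)%N -> d (u m) (u n) < e) ->
    exists l : T, u @ \oo --> l.

Definition metrizable (R : realType) (T : topologicalType) : Prop :=
  exists d : T -> T -> R, compatible_metric d.

Definition polish (R : realType) (T : topologicalType) : Prop :=
  separable T /\
  exists2 d : T -> T -> R, compatible_metric d & complete_metric d.

(* The finite levels of the Borel hierarchy, numbered from 1: level 0 is a
   dummy, and level n.+1 for n >= 1 consists of the countable unions of
   complements of sets of level n. *)
Fixpoint Sigma0 (T : topologicalType) (n : nat) : set (set T) :=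
  match n with
  | 0 => set0
  | 1 => open
  | m.+1 => [set A | exists2 F : nat -> set T,
               (forall i, Sigma0 m (~` F i)) & A = \bigcup_i F i]
  end.

Definition Pi0 (T : topologicalType) (n : nat) : set (set T) :=
  [set A | Sigma0 n (~` A)].

Definition Delta0 (T : topologicalType) (n : nat) : set (set T) :=
  Sigma0 n `&` @Pi0 T n.

Definition Sigma0_measurable (T U : topologicalType) (n : nat) (g : T -> U) :
    Prop :=
  forall V : set U, open V -> Sigma0 n (g @^-1` V).

(* [dec c d g] is "g is in dec(Sigma^0_c, Delta^0_d)". The pieces of the
   partition may be empty; [sigL (Z k) g] is the restriction of [g] to the
   subtype [Z k], which carries the subspace topology. *)
Definition dec (T U : topologicalType) (c d : nat) (g : T -> U) : Prop :=
  exists Z : nat -> set T,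
    [/\ trivIset setT Z,
        \bigcup_k Z k = setT,
        forall k, Delta0 d (Z k) &
        forall k, Sigma0_measurable c (sigL (Z k) g)].

(* Main.v *)
Require Import Defs.
From mathcomp Require Import all_boot all_order all_algebra.
From mathcomp Require Import boolp classical_sets functions cardinality.
From mathcomp Require Import reals topology.
From mathcomp Require Import lra.

Set Implicit Arguments.
Unset Strict Implicit.
Unset Printing Implicit Defensive.

Import Order.TTheory GRing.Theory Num.Theory.

Local Open Scope classical_set_scope.

(** Let [dec_ideal f a] be the sigma-ideal generated by the G_delta sets on which
    f is Sigma_a-measurable; f is in dec(Sigma_a, Delta_3) iff this ideal
    contains X. If it does not, a tree of G_delta sets P_k outside the ideal is
    grown together with pairs of open sets of Y separating f-values along it,
    and the open sets assemble to a set E of Y such that H := f^-1(Y \ E) in (i),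
    H := f^-1(E) in (ii), contains all branches of the tree. By hypothesis H is a union of
    G_delta sets, and by Baire category one of them meets every node below some
    node j; hence it also meets a set of points that are generic for j, which
    lie outside H by construction.

    For (i), the generic points of j are those of a G_delta set A_j mapped into
    an open set, the descendants being mapped off the closure of that open set.
    For (ii), f may be assumed of Baire class 1; a node has inner children,
    mapped into its open set, and outer siblings, mapped off it; branches take
    infinitely many inner steps, and generic points are limits of outer steps.

    A new open set W of Y shrinks the sets f^-1(Y \ cl W) in which all nodes
    already present have to grow further. What makes this harmless is that,
    at each point of the kernel of a chain of length n, among pairwise disjoint
    sets cl W at most n are harmful ([kernel_at_most]), and that a set outside
    the ideal always has room for a harmless W when the number of disjoint
    harmful ones is bounded ([Sep0_ideal_bounded]). *)

(** * Borel classes, regular bases and sigma-ideals *)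

Lemma bigcup_countType (T : Type) (K : set (set T)) (I : countType)
    (F : I -> set T) :
  K set0 -> (forall G : nat -> set T, (forall i, K (G i)) -> K (\bigcup_i G i)) ->
  (forall i, K (F i)) -> K (\bigcup_i F i).
Proof.
move=> K0 KU KF.
have -> : \bigcup_i F i = \bigcup_k (if unpickle k is Some i then F i else set0).
  apply/seteqP; split=> x.
    by move=> [i _ Fx]; exists (pickle i) => //; rewrite pickleK.
  by move=> [k _]; case: unpickle => // i Fx; exists i.
by apply: KU => k; case: unpickle.
Qed.

(** Second countability and regularity in one; together with [ball_structure], all that the argument
    uses of the metrics. *)
Definition regular_base (T : topologicalType) (U : nat -> set T) :=
  (forall i, open (U i)) /\
  forall O x, open O -> O x -> exists2 i, U i x & closure (U i) `<=` O.

Section Borel_classes.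
Context {T : topologicalType}.
Implicit Types (A B : set T) (n : nat).

Lemma Pi01E A : Pi0 1 A <-> closed A.
Proof. by rewrite -openC. Qed.

Lemma Sigma0_0T n : Sigma0 n.+1 (@set0 T) /\ Sigma0 n.+1 (@setT T).
Proof.
elim: n => [|n [IH0 IHT]]; first by split; [exact: open0|exact: openT].
split; [exists (fun=> set0)|exists (fun=> setT)].
- by move=> _; rewrite setC0.
- by rewrite bigcup_const.
- by move=> _; rewrite setCT.
- by rewrite bigcup_const.
Qed.

Lemma Sigma0S_bigcup n (I : countType) (F : I -> set T) :
  (forall i, Pi0 n.+1 (F i)) -> Sigma0 n.+2 (\bigcup_i F i).
Proof.
move=> FP.
exists (fun k => if unpickle k is Some i then F i else set0).
  move=> k; case: unpickle => [i|]; first exact: FP.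
  by rewrite setC0; exact: (Sigma0_0T n).2.
apply/seteqP; split=> x.
  by move=> [i _ Fx]; exists (pickle i) => //; rewrite pickleK.
by move=> [k _]; case: unpickle => // i Fx; exists i.
Qed.

Lemma Pi0_Sigma0S n A : Pi0 n.+1 A -> Sigma0 n.+2 A.
Proof. by move=> PA; exists (fun=> A) => //; rewrite bigcup_const. Qed.

Lemma Sigma0_bigcup n (I : countType) (F : I -> set T) :
  (forall i, Sigma0 n.+1 (F i)) -> Sigma0 n.+1 (\bigcup_i F i).
Proof.
case: n => [|n] FS; first by apply: bigcup_open => i _; exact: FS.
have /choice[G GP] : forall i, exists g : nat -> set T,
    (forall j, Pi0 n.+1 (g j)) /\ F i = \bigcup_j g j.
  by move=> i; have [g gS ->] := FS i; exists g.
have -> : \bigcup_i F i = \bigcup_(p : I * nat) G p.1 p.2.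
  apply/seteqP; split=> x.
    by move=> [i _]; rewrite (GP i).2 => -[j _ Gx]; exists (i, j).
  by move=> [[i j] _ Gx]; exists i => //; rewrite (GP i).2; exists j.
by apply: Sigma0S_bigcup => -[i j]; exact: (GP i).1.
Qed.

Lemma Sigma0U n A B : Sigma0 n.+1 A -> Sigma0 n.+1 B -> Sigma0 n.+1 (A `|` B).
Proof.
move=> SA SB; have -> : A `|` B = \bigcup_(b : bool) (if b then A else B).
  apply/seteqP; split=> x; first by move=> [Ax|Bx]; [exists true|exists false].
  by move=> [[] _ ?]; [left|right].
by apply: Sigma0_bigcup => -[].
Qed.

Lemma Sigma0I n A B : Sigma0 n.+1 A -> Sigma0 n.+1 B -> Sigma0 n.+1 (A `&` B).
Proof.
case: n => [|n]; first exact: openI.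
move=> [F FP ->] [G GP ->].
have -> : (\bigcup_i F i) `&` (\bigcup_i G i) =
    \bigcup_(p : nat * nat) (F p.1 `&` G p.2).
  apply/seteqP; split=> x.
    by move=> [[i _ Fx] [j _ Gx]]; exists (i, j).
  by move=> [[i j] _ [Fx Gx]]; split; [exists i|exists j].
apply: Sigma0S_bigcup => -[i j]; rewrite /Pi0/= setCI.
by apply: (@Sigma0U n); [exact: FP|exact: GP].
Qed.

Lemma Pi0_bigcap n (I : countType) (F : I -> set T) :
  (forall i, Pi0 n.+1 (F i)) -> Pi0 n.+1 (\bigcap_i F i).
Proof. by move=> FP; rewrite /Pi0/= setC_bigcap; exact: Sigma0_bigcup. Qed.

Lemma Pi0U n A B : Pi0 n.+1 A -> Pi0 n.+1 B -> Pi0 n.+1 (A `|` B).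
Proof. by move=> PA PB; rewrite /Pi0/= setCU; exact: Sigma0I. Qed.

Lemma Pi0I n A B : Pi0 n.+1 A -> Pi0 n.+1 B -> Pi0 n.+1 (A `&` B).
Proof. by move=> PA PB; rewrite /Pi0/= setCI; exact: Sigma0U. Qed.

Lemma Pi0C n A : Pi0 n (~` A) <-> Sigma0 n A.
Proof. by rewrite /Pi0/= setCK. Qed.

Lemma closed_Sigma02 A : closed A -> Sigma0 2 A.
Proof. by move=> cA; apply: Pi0_Sigma0S; exact/Pi01E. Qed.

Lemma Pi02P A : Pi0 2 A <->
  exists2 O : nat -> set T, (forall i, open (O i)) & A = \bigcap_i O i.
Proof.
split.
  move=> [F Fo AE]; exists (fun i => ~` F i) => //.
  by rewrite -setC_bigcup -AE setCK.
by move=> [O Oo ->]; rewrite /Pi0/= setC_bigcap; exists (fun i => ~` O i) => // i;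
  rewrite setCK.
Qed.

Lemma open_Pi02 A : open A -> Pi0 2 A.
Proof. by move=> oA; apply/Pi02P; exists (fun=> A) => //; rewrite bigcap_const. Qed.

Context {U : nat -> set T} (Ub : regular_base U).

Lemma open_Sigma02 A : open A -> Sigma0 2 A.
Proof.
move=> oA; have -> : A = \bigcup_i (closure (U i) `&` [set _ | closure (U i) `<=` A]).
  apply/seteqP; split=> x; last by move=> [i _ [? /= UA]]; exact: UA.
  move=> Ax; have [i Ux UA] := Ub.2 _ _ oA Ax.
  by exists i => //; split=> //; exact: subset_closure.
apply: Sigma0_bigcup => i; apply: closed_Sigma02; apply: closedI.
  exact: closed_closure.
have [UA|UA] := pselect (closure (U i) `<=` A).
  by rewrite (_ : mkset _ = setT); [exact: closedT|by apply/seteqP; split].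
by rewrite (_ : mkset _ = set0); [exact: closed0|by apply/seteqP; split].
Qed.

Lemma closed_Pi02 A : closed A -> Pi0 2 A.
Proof. by move=> cA; apply: open_Sigma02; exact: closed_openC. Qed.

Lemma Sigma02_Sigma03 A : Sigma0 2 A -> Sigma0 3 A.
Proof.
move=> [F Fo ->]; apply: Sigma0S_bigcup => i; apply: closed_Pi02.
by apply/Pi01E; exact: Fo.
Qed.

Lemma open_Sigma03 A : open A -> Sigma0 3 A.
Proof. by move=> oA; apply/Sigma02_Sigma03/open_Sigma02. Qed.

Lemma closed_Sigma03 A : closed A -> Sigma0 3 A.
Proof. by move=> cA; apply/Sigma02_Sigma03/closed_Sigma02. Qed.

End Borel_classes.

Definition sigma_ideal (T : Type) (I : set (set T)) :=
  [/\ I set0, forall A B, A `<=` B -> I B -> I A &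
      forall F : nat -> set T, (forall i, I (F i)) -> I (\bigcup_i F i)].

Section Sigma_ideal.
Context {T : Type} {I : set (set T)} (Is : sigma_ideal I).

Lemma ideal0 : I set0. Proof. by case: Is. Qed.

Lemma idealS A B : A `<=` B -> I B -> I A.
Proof. by case: Is => _ + _; exact. Qed.

Lemma ideal_bigcup (J : countType) (F : J -> set T) :
  (forall i, I (F i)) -> I (\bigcup_i F i).
Proof. by case: Is => I0 _ IU; exact: bigcup_countType. Qed.

Lemma idealU A B : I A -> I B -> I (A `|` B).
Proof.
move=> IA IB; apply: (@idealS _ (\bigcup_(b : bool) (if b then A else B))).
  by move=> x [Ax|Bx]; [exists true|exists false].
by apply: ideal_bigcup => -[].
Qed.

End Sigma_ideal.

(** * Kernels of chains *)

Section Kernel.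
Context {X Y : topologicalType} {U : nat -> set X} (Ub : regular_base U).
Context (V : nat -> set Y) (f : X -> Y).
Context {I : set (set X)} (Is : sigma_ideal I).

(** Asymmetric: [A] is covered entirely, [B] is avoided only modulo the ideal. *)
Definition Sep2 (A B : set X) :=
  exists S, [/\ Sigma0 2 S, A `<=` S & I (S `&` B)].

Lemma Sep2S A A' B B' : A' `<=` A -> B' `<=` B -> Sep2 A B -> Sep2 A' B'.
Proof.
move=> AA BB [S [S2 AS IS]]; exists S; split=> //; first exact: subset_trans AS.
by apply: (idealS Is) IS; exact: setIS.
Qed.

Lemma Sep2_bigcup (J : countType) (A : J -> set X) B :
  (forall i, Sep2 (A i) B) -> Sep2 (\bigcup_i A i) B.
Proof.
move=> /choice[S SP]; exists (\bigcup_i S i); split.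
- by apply: Sigma0_bigcup => i; have [] := SP i.
- by move=> x [i _ Ax]; exists i => //; have [_ + _] := SP i; exact.
- by rewrite setI_bigcupl; apply: (ideal_bigcup Is) => i; have [] := SP i.
Qed.

Lemma Sep2_empty A B : A `<=` set0 -> Sep2 A B.
Proof.
move=> A0; exists set0; split=> //; first exact: (Sigma0_0T 1).1.
by rewrite set0I; exact: (ideal0 Is).
Qed.

Lemma Sep2U A A' B : Sep2 A B -> Sep2 A' B -> Sep2 (A `|` A') B.
Proof.
move=> SA SA'; apply: (@Sep2S (\bigcup_(b : bool) (if b then A else A')) _ B) => //.
  by move=> x [Ax|Bx]; [exists true|exists false].
by apply: Sep2_bigcup => -[].
Qed.

(** Lindelof argument: the basic open sets on which separation is possible are countably many and
    cover [D], and their separators can be united. *)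
Lemma Sep2_local (A B D : set X) :
  (forall x, D x -> exists O, [/\ open O, O x & Sep2 (A `&` O) B]) ->
  Sep2 (A `&` D) B.
Proof.
move=> AD.
apply: (@Sep2S (\bigcup_i (A `&` U i `&` [set _ | Sep2 (A `&` U i) B])) _ B) => //.
  move=> x [Ax /AD[O [oO Ox SO]]]; have [i Ux UO] := Ub.2 _ _ oO Ox.
  exists i => //; split=> //=; apply: Sep2S SO => //; apply: setIS.
  exact: subset_trans (@subset_closure _ _) UO.
apply: Sep2_bigcup => i; have [SU|nSU] := pselect (Sep2 (A `&` U i) B).
  by apply: Sep2S SU => // x [].
by apply: Sep2_empty => x [].
Qed.

(* For nested pairs (A_0, B_0), ..., (A_n, B_n), listed from the last to the
   first: the closed set of points at which no A_i can be separated, modulo the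
   ideal, from B_i within the kernel of the previous pairs. *)
Fixpoint kernel (c : seq (set X * set X)) : set X :=
  if c is (A, B) :: c' then
    [set x | forall O, open O -> O x -> ~ Sep2 (A `&` kernel c' `&` O) (B `&` kernel c')]
  else setT.

Lemma kernel_closed c : closed (kernel c).
Proof.
case: c => [|[A B] c]; first exact: closedT.
rewrite -openC openE => x /= /existsNP[O /not_implyP[oO /not_implyP[Ox /contrapT S]]].
rewrite /interior nbhsE; exists O => //.
by move=> y Oy /(_ O oO Oy).
Qed.

Lemma kernel_sub e c : kernel (e :: c) `<=` kernel c.
Proof.
case: e => A B x Kx; apply: contrapT => nx.
apply: (Kx (~` kernel c)) => //; first exact/closed_openC/kernel_closed.
by apply: Sep2_empty => y [[_ ?]].
Qed.

Lemma kernel_drop i c : kernel c `<=` kernel (drop i c).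
Proof.
elim: c i => [|e c IH] [|i] //= x Kx; apply: IH; exact: (@kernel_sub e).
Qed.

Lemma kernel_compl_Sep A B c :
  Sep2 (A `&` kernel c `&` ~` kernel ((A, B) :: c)) (B `&` kernel c).
Proof.
apply: Sep2_local => x /= /existsNP[O /not_implyP[oO /not_implyP[Ox /contrapT S]]].
by exists O.
Qed.

(** Inseparability passes from the previous kernel to the new one: a separator inside the new
    kernel, cut down to that closed set, could be joined with the one off it from
    [kernel_compl_Sep]. *)
Lemma kernel_not_Sep A B c O x : kernel ((A, B) :: c) x -> open O -> O x ->
  ~ Sep2 (A `&` kernel ((A, B) :: c) `&` O) (B `&` kernel ((A, B) :: c)).
Proof.
set K := kernel _ => Kx oO Ox [S [S2 AS IS]].
apply: (Kx O oO Ox).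
apply: (@Sep2S ((A `&` K `&` O) `|` (A `&` kernel c `&` ~` K)) _ (B `&` kernel c)) => //.
  by move=> y [[Ay cy] Oy]; have [Ky|nKy] := pselect (K y); [left|right].
apply: Sep2U; last exact: kernel_compl_Sep.
exists (S `&` K); split.
- by apply: Sigma0I => //; apply: closed_Sigma02; exact: kernel_closed.
- by move=> y AKO; split; [exact: AS|case: AKO => -[]].
- by apply: (idealS Is) IS => y [[? ?] []].
Qed.

Lemma kernel_dense A B c O x : kernel ((A, B) :: c) x -> open O -> O x ->
  exists2 y, A y & (kernel ((A, B) :: c) `&` O) y.
Proof.
move=> Kx oO Ox; apply: contrapT => nE; apply: (kernel_not_Sep Kx oO Ox).
by apply: Sep2_empty => y [[Ay Ky] Oy]; apply: nE; exists y.
Qed.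

(** If [B] were null there, the kernel within [O] would itself be a separator. *)
Lemma kernel_positive A B c O x : kernel ((A, B) :: c) x -> open O -> O x ->
  ~ I (B `&` kernel ((A, B) :: c) `&` O).
Proof.
move=> Kx oO Ox IB; apply: (kernel_not_Sep Kx oO Ox).
exists (kernel ((A, B) :: c) `&` O); split.
- by apply: Sigma0I; [exact/closed_Sigma02/kernel_closed|exact: (open_Sigma02 Ub)].
- by move=> y [[]].
- by apply: (idealS Is) IB => y [[? ?] []].
Qed.

Lemma kernel_nonempty A B c : ~ Sep2 (A `&` kernel c) (B `&` kernel c) ->
  exists2 x, A x & kernel ((A, B) :: c) x.
Proof.
move=> nS; apply: contrapT => nE; apply: nS.
apply: Sep2S (kernel_compl_Sep A B c) => // y [Ay Ky]; split=> // Ky'.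
by apply: nE; exists y.
Qed.

(** With [setT] as first set, the separator of [kernel_compl_Sep] covers all of the removed part, so
    [B] is null there. *)
Lemma kernelT_null B c : I (B `&` kernel c `&` ~` kernel ((setT, B) :: c)).
Proof.
have [S [_ TS]] := kernel_compl_Sep setT B c.
by apply: (idealS Is) => y [[By Ky] nK]; split=> //; apply: TS.
Qed.

Definition avoid (C : set Y) (c : seq (set X * set X)) :=
  [seq (e.1, e.2 `\` f @^-1` C) | e <- c].

Definition closures_disjoint : rel nat := fun i j =>
  `[< closure (V i) `&` closure (V j) = set0 >].

Definition at_most (e : nat) (bad : pred nat) :=
  forall s, pairwise closures_disjoint s -> all bad s -> (size s <= e)%N.

Lemma at_most_or e1 e2 (b1 b2 : pred nat) :
  at_most e1 b1 -> at_most e2 b2 -> at_most (e1 + e2) (predU b1 b2).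
Proof.
move=> B1 B2 s ds bs.
apply: (@leq_trans (size [seq i <- s | b1 i] + size [seq i <- s | b2 i])).
  rewrite !size_filter; elim: s {ds} bs => //= i s IH /andP[+ /IH].
  by case: (b1 i) (b2 i) => -[] //= _ H; rewrite ?addnS ?addSn ?ltnS //;
    exact: leq_trans H _.
by apply: leq_add; [apply: B1|apply: B2];
  rewrite ?filter_all //; exact: (subseq_pairwise (filter_subseq _ _) ds).
Qed.

Lemma kernel_at_most c x : kernel c x ->
  at_most (size c) (fun i => `[< ~ kernel (avoid (closure (V i)) c) x >]).
Proof.
elim: c x => [|[A B] c IH] x Kx s ds /allP bs.
  by case: s bs {ds} => // i s /(_ i (mem_head _ _))/asboolP[].
rewrite leqNgt; apply/negP => sz.
pose Z i := kernel (avoid (closure (V i)) c).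
have /choice[OS OSP] : forall i, exists OS : set X * set X, i \in s ->
    [/\ open OS.1, OS.1 x, Sigma0 2 OS.2, A `&` Z i `&` OS.1 `<=` OS.2 &
    I (OS.2 `&` ((B `\` f @^-1` closure (V i)) `&` Z i))].
  move=> i; have [si|] := boolP (i \in s); last by exists (set0, set0).
  have /asboolP/= /existsNP[O /not_implyP[oO /not_implyP[Ox /contrapT[S [S2 AS IS]]]]]
    := bs i si.
  by exists (O, S) => _; split.
pose O := \bigcap_(i in [set` s]) (OS i).1.
have oO : open O.
  rewrite /O bigcap_seq; elim: s {ds bs sz O} OSP => [|i s IHs] OSP.
    by rewrite big_nil; exact: openT.
  rewrite big_cons; apply: openI; first by have [] := OSP i (mem_head _ _).
  by apply: IHs => j js; apply: OSP; rewrite inE js orbT.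
have Ox : O x by move=> i /= si; have [] := OSP i si.
apply: (Kx O oO Ox).
pose S (p : nat * nat) := (OS p.1).2 `&` Z p.1 `&` ((OS p.2).2 `&` Z p.2) `&`
  [set _ | [/\ p.1 \in s, p.2 \in s & closures_disjoint p.1 p.2]].
(* A point of A in the kernel of c fails for at most [size c] of the at least
   [size c + 2] closed sets, so it lies in two of the separating sets, while
   f y belongs to at most one of any two of them. *)
suff: Sep2 (\bigcup_p S p) (B `&` kernel c).
  apply: Sep2S => // a [[Aa Ka] Oa].
  pose g := [seq i <- s | `[< Z i a >]].
  have : (1 < size g)%N.
    have := @IH a Ka [seq i <- s | ~~ `[< Z i a >]].
    rewrite (subseq_pairwise (filter_subseq _ _) ds) => /(_ isT).
    have -> : all (fun i => `[< ~ kernel (avoid (closure (V i)) c) a >])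
        [seq i <- s | ~~ `[< Z i a >]].
      by apply/allP => i; rewrite mem_filter => /andP[/asboolPn nZ _]; exact/asboolP.
    move=> /(_ isT); rewrite size_filter => cs; move: sz.
    rewrite /g size_filter -(count_predC (fun i => `[< Z i a >]) s) => sz.
    rewrite -(ltn_add2r (count (predC (fun i => `[< Z i a >])) s)).
    by apply: leq_ltn_trans sz; rewrite add1n ltnS.
  have gs i : i \in g -> i \in s /\ Z i a.
    by rewrite mem_filter => /andP[/asboolP].
  have : pairwise closures_disjoint g by exact: (subseq_pairwise (filter_subseq _ _) ds).
  case: g gs => [|i [|j g]] // gs /andP[/andP[dij _] _] _.
  have [si Zi] := gs i (mem_head _ _).
  have [sj Zj] : j \in s /\ Z j a by apply: gs; rewrite in_cons mem_head orbT.
  exists (i, j) => //; split=> //; split; split=> //=.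
    by have [_ _ _ + _] := OSP i si; apply; split=> //; exact: Oa.
  by have [_ _ _ + _] := OSP j sj; apply; split=> //; exact: Oa.
have SepF : forall p, Sep2 (S p) (B `&` kernel c).
  move=> [i j].
  have [[/= si sj dij]|n] := pselect [/\ i \in s, j \in s & closures_disjoint i j];
    last by apply: Sep2_empty => y [].
  exists (S (i, j)); split=> //.
    have S2 k : k \in s -> Sigma0 2 ((OS k).2 `&` Z k).
      move=> sk; apply: Sigma0I; first by have [] := OSP k sk.
      exact/closed_Sigma02/kernel_closed.
    apply: Sigma0I; first by apply: Sigma0I; exact: S2.
    by rewrite (_ : mkset _ = setT); [exact: (Sigma0_0T 1).2|apply/seteqP; split].
  have [_ _ _ _ Ii] := OSP i si; have [_ _ _ _ Ij] := OSP j sj.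
  apply: (idealS Is) (idealU Is Ii Ij) => y [[[[/= Si Zi] [Sj Zj]] _] [By _]].
  have [Ci|Ci] := pselect (closure (V i) (f y)); last by left.
  right; split=> //; split=> //; split=> // Cj.
  have /asboolP dij0 := dij.
  by have : (closure (V i) `&` closure (V j)) (f y) by []; rewrite dij0.
exact: Sep2_bigcup.
Qed.

End Kernel.

Arguments Sep2 {X} I A B.
Arguments kernel {X} I c : simpl never.

(** * The ideal of decomposable sets *)

Section Decomposition_ideal.
Context {X Y : topologicalType} (f : X -> Y).

(* Equivalent to Sigma0-measurability of the restriction of f to N in the subspace
   topology ([measurable_onE]), but phrased with subsets of X. *)
Definition measurable_on (a : nat) (N : set X) := forall W : set Y, open W ->
  exists2 S, Sigma0 a S & f @^-1` W `&` N = S `&` N.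

Definition dec_ideal (a : nat) : set (set X) := [set A |
  exists2 N : nat -> set X, (forall k, Pi0 2 (N k) /\ measurable_on a (N k)) &
    A `<=` \bigcup_k N k].

Lemma measurable_onS a N N' : N' `<=` N -> measurable_on a N -> measurable_on a N'.
Proof.
move=> NN mN W oW; have [S S1 SE] := mN W oW; exists S => //.
have E : N' = N `&` N' by apply/esym/setIidPr.
by rewrite E !setIA SE.
Qed.

Lemma dec_ideal_Pi02 a N : Pi0 2 N -> measurable_on a N -> dec_ideal a N.
Proof. by move=> N2 mN; exists (fun=> N) => // x Nx; exists 0. Qed.

Lemma dec_ideal_sigma a : sigma_ideal (dec_ideal a.+1).
Proof.
have good0 : Pi0 2 (@set0 X) /\ measurable_on a.+1 set0.
  split; first exact/open_Pi02/open0.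
  by move=> W _; exists set0; [exact: (Sigma0_0T a).1|rewrite !setI0].
split.
- exact: (dec_ideal_Pi02 good0.1 good0.2).
- by move=> A B AB [N NP BN]; exists N => //; exact: subset_trans BN.
- move=> F FI; have /choice[N NP] : forall i, exists N : nat -> set X,
      (forall k, Pi0 2 (N k) /\ measurable_on a.+1 (N k)) /\ F i `<=` \bigcup_k N k.
    by move=> i; have [N] := FI i; exists N.
  exists (fun k => if @unpickle (nat * nat)%type k is Some p
                   then N p.1 p.2 else set0).
    by move=> k; case: unpickle => // -[i j]; exact: (NP i).1.
  move=> x [i _ /(NP i).2[j _ Nx]]; exists (pickle (i, j)) => //.
  by rewrite pickleK.
Qed.

End Decomposition_ideal.

(** * Separability of all base pairs puts a set in the ideal *)

Section Localization.
Context {X Y : topologicalType} {U : nat -> set X} (Ub : regular_base U).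
Context {V : nat -> set Y} (Vb : regular_base V) (f : X -> Y).
Context (f3 : forall W, open W -> Sigma0 3 (f @^-1` W)).

(* [p = (i, j)] encodes a pair of open sets V_j, V_i with cl V_j <= V_i and
   cl V_i <= O. *)
Definition base_pair (O : set Y) (p : nat * nat) :=
  closure (V p.1) `<=` O /\ closure (V p.2) `<=` V p.1.

Lemma base_pairP (O W : set Y) y : open O -> open W -> O y -> W y ->
  exists p, [/\ base_pair O p, closure (V p.1) `<=` W & V p.2 y].
Proof.
move=> oO oW Oy Wy; have [i iy iO] := Vb.2 _ _ (openI oO oW) (conj Oy Wy).
have [j jy ji] := Vb.2 _ _ (Vb.1 i) iy.
by exists (i, j); split=> //; [split=> // z /iO[]|move=> z /iO[]].
Qed.

Section General.
Context {I : set (set X)} (Is : sigma_ideal I) (X0 : set X).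
(** Stands for [Sep2] with the ideal [dec_ideal f 2] in (i) and for [Sep1] with [dec_ideal f 1] in
    (ii), so that one tree construction serves both. *)
Context (Sep0 : set X -> set X -> Prop).
Hypothesis Sep0S : forall A A' B B', A' `<=` A -> B' `<=` B ->
  Sep0 A B -> Sep0 A' B'.
Hypothesis Sep0_open : forall A B W, open W -> I (W `&` B) ->
  Sep0 (A `\` W) (B `\` W) -> Sep0 A B.
Hypothesis Sep0_ideal : forall P O, P `<=` X0 -> Sigma0 3 P -> open O ->
  P `<=` f @^-1` O ->
  (forall p, base_pair O p ->
     Sep0 (P `&` f @^-1` V p.2) (P `\` f @^-1` closure (V p.1))) ->
  I P.

(* W i collects the points at which removing cl V_i is harmful. Induction on e:
   on W i, one harmful set is used up for the values of f outside cl V_i, so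
   that part of P is in the ideal, and W i may be added to a separating set. *)
Lemma Sep0_ideal_bounded e P O (W : nat -> set X) :
  P `<=` X0 -> Sigma0 3 P -> open O -> P `<=` f @^-1` O ->
  (forall i, open (W i)) ->
  (forall x, P x -> at_most V e (fun i => `[< closure (V i) `<=` O /\ W i x >])) ->
  (forall p, base_pair O p ->
     Sep0 ((P `&` f @^-1` V p.2) `\` W p.1)
          ((P `\` f @^-1` closure (V p.1)) `\` W p.1)) ->
  I P.
Proof.
elim: e P O => [|e IH] P O PX0 P3 oO PO oW WB S0.
  apply: (Sep0_ideal PX0 P3 oO PO) => p pO.
  suff PW x : P x -> ~ W p.1 x.
    by apply: Sep0S (S0 p pO) => x [Px Hx]; split=> //; exact: PW.
  move=> Px Wx; have := WB x Px [:: p.1] isT.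
  by rewrite /= andbT asboolT; [move=> /(_ isT)|case: pO].
apply: (Sep0_ideal PX0 P3 oO PO) => p pO.
apply: (Sep0_open (oW p.1)); last exact: S0.
apply: (IH _ (O `\` closure (V p.1))).
- by move=> x [_ [Px _]]; exact: PX0.
- apply: Sigma0I; first exact: (open_Sigma03 Ub (oW _)).
  by apply: Sigma0I => //; apply: (f3 (W := ~` _)); exact/closed_openC/closed_closure.
- by apply: openI => //; exact/closed_openC/closed_closure.
- by move=> x [_ [Px nC]]; split=> //; exact: PO.
- by [].
- move=> x [Wx [Px _]] s ds /allP bs; rewrite -ltnS.
  apply: (WB x Px (p.1 :: s)).
    rewrite pairwise_cons ds andbT; apply/allP => j /bs/asboolP[VO _].
    apply/asboolP/seteqP; split=> // y [Cy /VO[]].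
    by [].
  rewrite /=; apply/andP; split; first by apply/asboolP; split=> //; case: pO.
  by apply/allP => j /bs/asboolP[VO Wj]; apply/asboolP; split=> // y /VO[].
- move=> q [qO qq]; apply: Sep0S (S0 q _).
  + by move=> x [[[_ [Px _]] Vx] nW].
  + by move=> x [[[_ [Px _]] Vx] nW].
  + by split=> // y /qO[].
Qed.
End General.

Lemma pair_guard (K : set (set X)) (Q : Prop) (A : set X) :
  K set0 -> (Q -> K A) -> K (A `&` [set _ | Q]).
Proof.
move=> K0 KA; have [q|nq] := pselect Q.
  by rewrite (_ : mkset _ = setT) ?setIT; [exact: KA|apply/seteqP; split].
by rewrite (_ : mkset _ = set0) ?setI0 //; apply/seteqP; split.
Qed.

Lemma Sep2_open (I : set (set X)) : sigma_ideal I -> forall A B W, open W ->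
  I (W `&` B) -> Sep2 I (A `\` W) (B `\` W) -> Sep2 I A B.
Proof.
move=> Is A B W oW IW [S [S2 AS IS]]; exists (S `|` W); split.
- by apply: Sigma0U => //; exact: (open_Sigma02 Ub oW).
- by move=> x Ax; have [Wx|nW] := pselect (W x); [right|left; apply: AS].
- apply: (idealS Is) (idealU Is IS IW) => x [SW Bx].
  have [Wx|nW] := pselect (W x); first by right.
  by left; case: SW.
Qed.

(** Within the G_delta set [G] below, the separators of the pairs inside [W] unite on each G_delta
    piece of [P] to f^-1(W), so f is Sigma_2-measurable there; the rest of [P] is null. *)
Lemma Sep2_ideal P O : Sigma0 3 P -> open O -> P `<=` f @^-1` O ->
  (forall p, base_pair O p ->
     Sep2 (dec_ideal f 2) (P `&` f @^-1` V p.2) (P `\` f @^-1` closure (V p.1))) ->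
  dec_ideal f 2 P.
Proof.
set I := dec_ideal f 2; have Is : sigma_ideal I := dec_ideal_sigma f 1.
move=> [Pn Pn2 PE] oO PO S0.
have /choice[F FP] : forall p, exists F : nat -> set X, base_pair O p ->
    [/\ forall k, closed (F k), P `&` f @^-1` V p.2 `<=` \bigcup_k F k &
        I ((\bigcup_k F k) `&` (P `\` f @^-1` closure (V p.1)))].
  move=> p; have [pO|npO] := pselect (base_pair O p); last by exists (fun=> set0).
  have [_ [[F Fo ->] PS IS]] := S0 p pO; exists F => _; split=> // k.
  exact/Pi01E/Fo.
pose N := \bigcup_p (((\bigcup_k F p k) `&` (P `\` f @^-1` closure (V p.1))) `&`
  [set _ | base_pair O p]).
have IN : I N.
  apply: (ideal_bigcup Is) => p; apply: pair_guard; first exact: (ideal0 Is).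
  by case/(FP p).
have [Nk NkP NN] := IN; pose N' := \bigcup_k Nk k.
have IN' : I N' by exists Nk.
(* Points x such that any two of the closed sets F through x share a point x' of
   P off N'. If f x were outside some cl V_p.1 with x in F p k, then a second pair
   q, with disjoint closure around f x, would put f x' in both closures. *)
pose G := \bigcap_(r : (nat * nat) * (nat * nat) * (nat * nat))
  [set x | base_pair O r.1.1 -> base_pair O r.1.2 ->
    F r.1.1 r.2.1 x -> F r.1.2 r.2.2 x ->
    exists x', [/\ P x', ~ N' x', F r.1.1 r.2.1 x' & F r.1.2 r.2.2 x']].
have G2 : Pi0 2 G.
  apply: Pi0_bigcap => -[[p q] [k l]] /=.
  (* [E] does not involve [x], so each set is the whole space or the complement of an intersection
     of two closed sets. *)
  set E := exists _, _.
  have [pO|npO] := pselect (base_pair O p); last first.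
    by rewrite (_ : mkset _ = setT);
      [exact/open_Pi02/openT|apply/seteqP; split=> // x _ ?].
  have [qO|nqO] := pselect (base_pair O q); last first.
    by rewrite (_ : mkset _ = setT);
      [exact/open_Pi02/openT|apply/seteqP; split=> // x _ ? ?].
  have [e|ne] := pselect E.
    by rewrite (_ : mkset _ = setT);
      [exact/open_Pi02/openT|apply/seteqP; split=> // x _ ? ? ? ?].
  rewrite (_ : mkset _ = ~` (F p k `&` F q l)).
    apply: open_Pi02; apply: closed_openC.
    by apply: closedI; [have [] := FP p pO|have [] := FP q qO].
  apply/seteqP; split=> x /=.
    by move=> /(_ pO qO) h [/h/[apply]].
  by move=> nF _ _ Fp Fq; case: nF.
have PG : I (P `&` G).
  rewrite PE setI_bigcupl; apply: (ideal_bigcup Is) => n.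
  apply: dec_ideal_Pi02; first by apply: Pi0I => //; exact: Pn2.
  have PnP : Pn n `<=` P by rewrite PE => x ?; exists n.
  move=> W oW; exists (\bigcup_p (\bigcup_k F p k `&`
      [set _ | base_pair O p /\ closure (V p.1) `<=` W])).
    apply: Sigma0_bigcup => p; apply: pair_guard; first exact: (Sigma0_0T 1).1.
    move=> [pO _]; apply: Sigma0_bigcup => k; apply: closed_Sigma02.
    by have [] := FP p pO.
  apply/seteqP; split=> x [+ [Pnx Gx]]; have Px := PnP _ Pnx.
    move=> Wx; split=> //; have [p [pO pW px]] := base_pairP oO oW (PO x Px) Wx.
    by exists p => //; split=> //; have [_ + _] := FP p pO; apply.
  move=> [p _ [[k _ Fx] [pO pW]]]; split=> //=; apply: contrapT => nW.
  have nC : (~` closure (V p.1)) (f x) by move=> /pW.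
  have oC : open (~` closure (V p.1)) by exact/closed_openC/closed_closure.
  have [q [qO qC qx]] := base_pairP oO oC (PO x Px) nC.
  have [l _ Fl] : (\bigcup_l F q l) x by have [_ + _] := FP q qO; apply.
  have [x' [Px' nN Fx' Fl']] := Gx (p, q, (k, l)) Logic.I pO qO Fx Fl.
  have C1 : closure (V p.1) (f x').
    apply: contrapT => nC'; apply: nN; apply: NN; exists p => //; split=> //.
    by split; [exists k|].
  suff C2 : closure (V q.1) (f x') by exact: (qC _ C2).
  apply: contrapT => nC'; apply: nN; apply: NN; exists q => //; split=> //.
  by split; [exists l|].
apply: (idealS Is) (idealU Is PG IN') => x Px.
have [Gx|] := pselect (G x); [by left|right].
(* Outside [G] some two of the closed sets through [x] share no point of [P] off [N']; being in
   both, [x] lies in [N']. *)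
move: b => /existsNP[r /not_implyP[_ /=]].
move=> /not_implyP[_ /not_implyP[_ /not_implyP[Fp /not_implyP[Fq ne]]]].
by apply: contrapT => nN; apply: ne; exists x.
Qed.

(** In (ii) the separator is open, and may fail on both sides by a null set. *)
Definition Sep1 (I : set (set X)) (A B : set X) :=
  exists S, [/\ open S, I (A `\` S) & I (S `&` B)].

Lemma Sep1S (I : set (set X)) : sigma_ideal I -> forall A A' B B', A' `<=` A ->
  B' `<=` B -> Sep1 I A B -> Sep1 I A' B'.
Proof.
move=> Is A A' B B' AA BB [S [oS IA IB]]; exists S; split=> //.
  by apply: (idealS Is) IA => x [/AA].
by apply: (idealS Is) IB => x [? /BB].
Qed.

Lemma Sep1_open (I : set (set X)) : sigma_ideal I -> forall A B W, open W ->
  I (W `&` B) -> Sep1 I (A `\` W) (B `\` W) -> Sep1 I A B.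
Proof.
move=> Is A B W oW IW [S [oS IA IS]]; exists (S `|` W); split.
- exact: openU.
- by apply: (idealS Is) IA => x [Ax /not_orP[nS nW]].
- apply: (idealS Is) (idealU Is IS IW) => x [SW Bx].
  have [Wx|nW] := pselect (W x); first by right.
  by left; case: SW.
Qed.

(** As f is Sigma_2-measurable on [X0], preimages can be replaced by Sigma_2 sets [T], so the open
    separators are exact on the trace of a G_delta set [G]. There f is continuous, and the rest of
    [P] is null. *)
Lemma Sep1_ideal X0 P O : measurable_on f 2 X0 -> P `<=` X0 -> Sigma0 3 P ->
  open O -> P `<=` f @^-1` O ->
  (forall p, base_pair O p ->
     Sep1 (dec_ideal f 1) (P `&` f @^-1` V p.2) (P `\` f @^-1` closure (V p.1))) ->
  dec_ideal f 1 P.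
Proof.
set I := dec_ideal f 1; have Is : sigma_ideal I := dec_ideal_sigma f 0.
move=> m0 PX0 [Pn Pn2 PE] oO PO S0.
have /choice[S SP] : forall p, exists S, base_pair O p ->
    [/\ open S, I ((P `&` f @^-1` V p.2) `\` S) &
     I (S `&` (P `\` f @^-1` closure (V p.1)))].
  move=> p; have [pO|npO] := pselect (base_pair O p); last by exists set0.
  by have [S SP] := S0 p pO; exists S.
have /choice[T TP] : forall W : set Y, exists T, open W ->
    Sigma0 2 T /\ f @^-1` W `&` X0 = T `&` X0.
  move=> W; have [oW|noW] := pselect (open W); last by exists set0.
  by have [T T2 TE] := m0 W oW; exists T.
have TV j : open (V j) := Vb.1 j.
have TC i : open (~` closure (V i)) by exact/closed_openC/closed_closure.
have TE (W : set Y) x : open W -> P x -> W (f x) <-> T W x.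
  move=> oW /PX0 Xx; have [_ E] := TP W oW.
  split=> [Wx|Tx]; first by have : (f @^-1` W `&` X0) x by []; rewrite E => -[].
  by have : (T W `&` X0) x by []; rewrite -E => -[].
pose N := \bigcup_p ((((P `&` f @^-1` V p.2) `\` S p) `|`
   (S p `&` (P `\` f @^-1` closure (V p.1)))) `&` [set _ | base_pair O p]).
have IN : I N.
  apply: (ideal_bigcup Is) => p; apply: pair_guard; first exact: (ideal0 Is).
  by case/(SP p) => _ I1 I2; exact: idealU.
have [Nk NkP NN] := IN; pose N' := \bigcup_k Nk k.
have IN' : I N' by exists Nk.
pose G := \bigcap_p [set x | base_pair O p ->
  (T (V p.2) x -> S p x) /\ (S p x -> ~ T (~` closure (V p.1)) x)].
have G2 : Pi0 2 G.
  apply: Pi0_bigcap => p; have [pO|npO] := pselect (base_pair O p); last first.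
    by rewrite (_ : mkset _ = setT);
      [exact/open_Pi02/openT|apply/seteqP; split=> // x _ ?].
  have [oS _ _] := SP p pO.
  rewrite (_ : mkset _ = (~` T (V p.2) `|` S p) `&`
     (~` S p `|` ~` T (~` closure (V p.1)))).
    apply: Pi0I; apply: Pi0U.
    - exact: ((Pi0C 2 _).2 (TP _ (TV p.2)).1).
    - exact: open_Pi02.
    - exact/(closed_Pi02 Ub)/open_closedC.
    - exact: ((Pi0C 2 _).2 (TP _ (TC p.1)).1).
  apply/seteqP; split=> x /=.
    move=> /(_ pO)[h1 h2]; split.
      by have [/h1|] := pselect (T (V p.2) x); [right|left].
    by have [/h2|] := pselect (S p x); [right|left].
  by move=> [[nT|Sx] [nS|nC]] _; split.
have PG : I (P `&` G).
  rewrite PE setI_bigcupl; apply: (ideal_bigcup Is) => n.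
  apply: dec_ideal_Pi02; first by apply: Pi0I => //; exact: Pn2.
  have PnP : Pn n `<=` P by rewrite PE => x ?; exists n.
  move=> W oW; exists (\bigcup_p (S p `&`
      [set _ | base_pair O p /\ closure (V p.1) `<=` W])).
    apply: Sigma0_bigcup => p; apply: pair_guard; first exact: (Sigma0_0T 0).1.
    by move=> [pO _]; have [] := SP p pO.
  apply/seteqP; split=> x [+ [Pnx Gx]]; have Px := PnP _ Pnx.
    move=> Wx; split=> //; have [p [pO pW px]] := base_pairP oO oW (PO x Px) Wx.
    by exists p => //; split=> //; apply: (Gx p Logic.I pO).1; apply/TE.
  move=> [p _ [Sx [pO pW]]]; split=> //=; apply: pW; apply: contrapT => nC.
  by apply: (Gx p Logic.I pO).2 => //; apply/TE.
apply: (idealS Is) (idealU Is PG IN') => x Px.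
have [Nx|nN] := pselect (N' x); [by right|left; split=> // p _ pO].
split.
  move=> /(TE _ _ (TV _) Px) Vx; apply: contrapT => nS; apply: nN; apply: NN.
  by exists p => //; split=> //; left.
move=> Sx /(TE _ _ (TC _) Px) nC; apply: nN; apply: NN.
by exists p => //; split=> //; right.
Qed.

End Localization.

Arguments base_pair {Y} V O p.

(** * Sequences determined by finite histories *)

Section History.
Context {N : Type}.

Definition extend (g : nat -> N) (K : nat) (n : N) : nat -> N :=
  fun k => if k == K then n else g k.

Lemma extend_lt g K n k : (k < K)%N -> extend g K n k = g k.
Proof. by rewrite /extend; case: eqP => // ->; rewrite ltnn. Qed.

Lemma extend_eq g K n : extend g K n K = n.
Proof. by rewrite /extend eqxx. Qed.

(** [Q K] may look at all of [g], whose values from [K] on are defaults; hence only agreement below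
    [K] with the limit is claimed. *)
Lemma history_choice (d : N) (Q : nat -> (nat -> N) -> Prop) :
  Q 0 (fun=> d) ->
  (forall K g, Q K g -> exists n, Q K.+1 (extend g K n)) ->
  exists h, forall K, exists2 g, (forall k, (k < K)%N -> g k = h k) & Q K g.
Proof.
move=> Q0 QS.
have /choice[F FP] : forall s : nat * (nat -> N), exists n,
    Q s.1 s.2 -> Q s.1.+1 (extend s.2 s.1 n).
  move=> [K g] /=; have [/QS[n]|nQ] := pselect (Q K g); first by exists n.
  by exists d.
pose st := fix st K := if K is K'.+1 then extend (st K') K' (F (K', st K')) else fun=> d.
exists (fun k => st k.+1 k) => K; exists (st K); last first.
  by elim: K => [|K IH] //=; exact: (FP (K, st K)).
elim: K => // K IH k; rewrite ltnS leq_eqVlt => /orP[/eqP->//|kK].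
by rewrite /= extend_lt // IH.
Qed.

End History.

(** * Choosing the open sets of a new node *)

Section Step.
Context {X Y : topologicalType} {U : nat -> set X} (Ub : regular_base U).
Context {V : nat -> set Y} (Vb : regular_base V) (f : X -> Y).
Context (f3 : forall W, open W -> Sigma0 3 (f @^-1` W)).
Context {I : set (set X)} (Is : sigma_ideal I) (X0 : set X).
Context (Sep0 : set X -> set X -> Prop).
Hypothesis Sep0S : forall A A' B B', A' `<=` A -> B' `<=` B ->
  Sep0 A B -> Sep0 A' B'.
Hypothesis Sep00 : forall B, Sep0 set0 B.
Hypothesis Sep0_open : forall A B W, open W -> I (W `&` B) ->
  Sep0 (A `\` W) (B `\` W) -> Sep0 A B.
Hypothesis Sep0_ideal : forall P O, P `<=` X0 -> Sigma0 3 P -> open O ->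
  P `<=` f @^-1` O ->
  (forall p, base_pair V O p ->
     Sep0 (P `&` f @^-1` V p.2) (P `\` f @^-1` closure (V p.1))) ->
  I P.

Notation C i := (closure (V i)).
Notation chain := (seq (set X * set X)).

Lemma at_mostS e e' (b b' : pred nat) : (e <= e')%N -> (forall i, b' i -> b i) ->
  at_most V e b -> at_most V e' b'.
Proof.
move=> ee bb B s ds bs; apply: leq_trans ee; apply: B => //.
by apply: sub_all bs => i; exact: bb.
Qed.

Lemma requirements_at_most n (q : nat -> chain) (x : nat -> X) :
  (forall k, (k < n)%N -> kernel I (q k) (x k)) ->
  at_most V (\sum_(k < n) size (q k))
    (fun i => `[< exists2 k, (k < n)%N & ~ kernel I (avoid f (C i) (q k)) (x k) >]).
Proof.
elim: n => [|n IH] qx.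
  by move=> [|i s] //= _ /andP[/asboolP[]].
rewrite big_ord_recr /=.
have B1 := IH (fun k kn => qx k (ltnW kn)).
have B2 := kernel_at_most (V := V) (f := f) Is (qx n (ltnSn n)).
apply: at_mostS (at_most_or B1 B2) => // i /asboolP[k]; rewrite ltnS leq_eqVlt.
move=> /orP[/eqP->|kn] nK; apply/orP; [right|left]; apply/asboolP => //.
by exists k.
Qed.

(** If every pair were harmful to an earlier requirement or separable in its new kernel,
    [Sep0_ideal_bounded] would put [P] in the ideal: disjoint harmful sets are bounded in number by
    the total length of the chains. *)
Lemma step P c O n (q : nat -> chain) (x : nat -> X) :
  P `<=` X0 -> Sigma0 3 P -> ~ I P -> P `<=` kernel I c -> open O ->
  P `<=` f @^-1` O -> (forall k, (k < n)%N -> kernel I (q k) (x k)) ->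
  exists p, [/\ base_pair V O p,
    forall k, (k < n)%N -> kernel I (avoid f (C p.1) (q k)) (x k) &
    ~ Sep0 ((P `&` f @^-1` V p.2) `&` kernel I (avoid f (C p.1) c))
           ((P `\` f @^-1` C p.1) `&` kernel I (avoid f (C p.1) c))].
Proof.
move=> PX0 P3 nP Pc oO PO qx; apply: contrapT => nE; apply: nP.
pose bad i := exists2 k, (k < n)%N & ~ kernel I (avoid f (C i) (q k)) (x k).
(* A closure harming an earlier node counts as harmful everywhere: its [W] is the whole space, and
   only empty sets have to be separated. *)
pose W i := ~` kernel I (avoid f (C i) c) `|` [set _ | bad i].
apply: (@Sep0_ideal_bounded _ _ _ Ub _ f f3 _ X0 Sep0 Sep0S Sep0_open Sep0_ideal
  (size c + \sum_(k < n) size (q k)) _ O W) => //.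
- move=> i; apply: openU; first exact/closed_openC/kernel_closed.
  have [b|nb] := pselect (bad i).
    by rewrite (_ : mkset _ = setT); [exact: openT|apply/seteqP; split].
  by rewrite (_ : mkset _ = set0); [exact: open0|apply/seteqP; split].
- move=> y /Pc cy.
  have cB := kernel_at_most (V := V) (f := f) Is cy.
  apply: at_mostS (at_most_or cB (requirements_at_most qx)) => //.
  by move=> i /asboolP[_ [nK|b]]; apply/orP; [left|right]; apply/asboolP.
- move=> p pO; apply: contrapT => nS; apply: nE; exists p; split=> //.
    move=> k kn; apply: contrapT => nK; apply: nS.
    by apply: Sep0S (Sep00 set0) => y [_]; apply; right; exists k.
  apply: contra_not nS; apply: Sep0S => y [Py /not_orP[/contrapT Ky _]]; split=> //.
Qed.

End Step.

Lemma open_forall_lt (T : topologicalType) n (F : nat -> set T) :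
  (forall k, (k < n)%N -> open (F k)) ->
  open [set z | forall k, (k < n)%N -> F k z].
Proof.
elim: n => [|n IH] Fo.
  by rewrite (_ : mkset _ = setT); [exact: openT|apply/seteqP; split].
rewrite (_ : mkset _ = [set z | forall k, (k < n)%N -> F k z] `&` F n).
  by apply: openI; [apply: IH => k kn; apply: Fo; exact: ltnW|exact: Fo].
apply/seteqP; split=> z /=.
  by move=> h; split=> [k kn|]; apply: h => //; exact: ltnW.
by move=> [h hn] k; rewrite ltnS leq_eqVlt => /orP[/eqP->//|]; exact: h.
Qed.

Lemma open_imply (T : topologicalType) (Q : Prop) (F : set T) :
  (Q -> open F) -> open [set z | Q -> F z].
Proof.
move=> Fo; have [q|nq] := pselect Q.
  by rewrite (_ : mkset _ = F); [exact: Fo|apply/seteqP; split=> z //=; apply].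
by rewrite (_ : mkset _ = setT); [exact: openT|apply/seteqP; split=> // z _ ?].
Qed.

Lemma schedule_exists (T : countType) (v0 : T) :
  exists s : nat -> T, forall v N, exists2 K, (N <= K)%N & s K = v.
Proof.
(* The exponent of 2 in [K] codes the value, and the factor 3^N makes [K] large without changing
   it. *)
exists (fun K => odflt v0 (unpickle (logn 2 K))) => v N.
exists (2 ^ pickle v * 3 ^ N)%N.
  apply: leq_trans (leq_pmull _ _); last by rewrite expn_gt0.
  exact/ltnW/ltn_expl.
by rewrite lognM ?expn_gt0// pfactorK// lognX muln0 addn0 pickleK.
Qed.

(** * Growing the tree *)

(* What is needed of the open and closed balls of radius 1/(n+1) of a complete
   metric. *)
Record ball_structure (X : topologicalType) (ob cb : X -> nat -> set X) : Prop :=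
  BallStructure {
  ball_open : forall x n, open (ob x n);
  ball_center : forall x n, ob x n x;
  ball_sub : forall x n, ob x n `<=` cb x n;
  ball_small : forall O x K, open O -> O x -> exists2 n, (K <= n)%N & cb x n `<=` O;
  ball_nested : forall (x : nat -> X) (n : nat -> nat), (forall i, (i <= n i)%N) ->
    (forall i, cb (x i.+1) (n i.+1) `<=` cb (x i) (n i)) ->
    exists2 z, forall i, cb (x i) (n i) z &
      forall O, open O -> O z -> exists i, cb (x i) (n i) `<=` O }.

(* A node k carries sets A_k and P_k, a [base_pair] of open sets of Y, the node
   whose region its values lie in (None for the whole of Y), the chain of pairs
   inside whose kernel it was created, and a ball. A label (t, m) in a chain
   stands for the pair (A_t, P_t restricted to the region m). *)
Record node (X : Type) := Node {
  nA : set X; nP : set X; np : nat * nat; nm : option nat;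
  nc : seq (nat * option nat); nx : X; nr : nat }.

Section Construction.
Context {X Y : topologicalType} {U : nat -> set X} (Ub : regular_base U).
Context {V : nat -> set Y} (Vb : regular_base V) (f : X -> Y).
Context (f3 : forall W, open W -> Sigma0 3 (f @^-1` W)).
Context {I : set (set X)} (Is : sigma_ideal I) (X0 : set X).
Context (Sep0 : set X -> set X -> Prop).
Hypothesis Sep0S : forall A A' B B', A' `<=` A -> B' `<=` B ->
  Sep0 A B -> Sep0 A' B'.
Hypothesis Sep00 : forall B, Sep0 set0 B.
Hypothesis Sep0_open : forall A B W, open W -> I (W `&` B) ->
  Sep0 (A `\` W) (B `\` W) -> Sep0 A B.
Hypothesis Sep0_ideal : forall P O, P `<=` X0 -> Sigma0 3 P -> open O ->
  P `<=` f @^-1` O ->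
  (forall p, base_pair V O p ->
     Sep0 (P `&` f @^-1` V p.2) (P `\` f @^-1` closure (V p.1))) ->
  I P.
Context {ob cb : X -> nat -> set X} (Bs : ball_structure ob cb).
Context {po : set X -> nat -> set X} (po_open : forall A l, open (po A l)).
Hypothesis poE : forall A, Pi0 2 A -> A = \bigcap_l po A l.
Context (sched : nat -> nat * nat * nat) (inner : bool).
Context (side : set X -> set X -> nat * nat -> Prop).

Notation C i := (closure (V i)).
Notation node := (node X).
Notation label := (nat * option nat)%type.

(* The pairs put on top of the chain by a new node; those of the first list
   serve to create inner children, which are needed for (ii) only. *)
Definition newpos (A P : set X) (p : nat * nat) : seq (set X * set X) :=
  (if inner then [:: (A, P `&` f @^-1` V p.2)] else [::]) ++
  [:: (A, P `\` f @^-1` C p.1)].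

Hypothesis newposP : forall P p c, Pi0 2 P -> P `<=` X0 ->
  ~ Sep0 ((P `&` f @^-1` V p.2) `&` kernel I c)
         ((P `\` f @^-1` C p.1) `&` kernel I c) ->
  exists A x, [/\ Pi0 2 A, side A P p, P x & kernel I (newpos A P p ++ c) x].

Implicit Types (g : nat -> node) (m : option nat) (q : seq label) (K : nat).

Definition okm K m := if m is Some j then (j < K)%N else true.
Definition valid K (t : label) := (t.1 < K)%N && okm K t.2.
Definition after m w := if m is Some j then (j < w)%N else true.

(* The open set of values still available to new nodes of the family of m at
   stage K: the inner open set of m minus the closures used since then. *)
Definition region g m K : set Y :=
  [set y | (if m is Some j then V (np (g j)).2 y else True) /\
     forall w, (w < K)%N -> after m w -> ~ C (np (g w)).1 y].

(** Chains are stored as labels because the sets they denote shrink with each stage; this is their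
    meaning at stage [K]. *)
Definition ev g K q : seq (set X * set X) :=
  [seq (nA (g t.1), nP (g t.1) `&` f @^-1` region g t.2 K) | t <- q].

Definition base g k : seq label := (k, nm (g k)) :: nc (g k).
Definition pos g k : seq label :=
  if inner then (k, Some k) :: base g k else base g k.

Lemma region_open g m K : open (region g m K).
Proof.
apply: openI.
  by case: m => [j|]; [exact: Vb.1|rewrite -/setT; exact: openT].
apply: open_forall_lt => w _; apply: open_imply => _.
exact/closed_openC/closed_closure.
Qed.

Lemma region_agree g g' m K : okm K m -> (forall k, (k < K)%N -> g k = g' k) ->
  region g m K = region g' m K.
Proof.
move=> mK gg; apply/seteqP; split=> y [ym yw]; split=> [|w wK];
  try by have := yw w wK; rewrite gg.
  by case: m mK ym {yw} => // j jK; rewrite gg.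
by case: m mK ym {yw} => // j jK; rewrite gg.
Qed.

Lemma regionS g m K : okm K m -> region g m K.+1 = region g m K `\` C (np (g K)).1.
Proof.
move=> mK; apply/seteqP; split=> y.
  move=> [ym yw]; split; first by split=> // w wK; apply: yw; exact: ltnW.
  by apply: yw => //; case: m mK {ym}.
move=> [[ym yw] yK]; split=> // w; rewrite ltnS leq_eqVlt => /orP[/eqP->//|].
exact: yw.
Qed.

Lemma region_new g K : region g (Some K) K.+1 = V (np (g K)).2.
Proof.
apply/seteqP; split=> y; first by case.
by move=> yV; split=> // w; rewrite ltnS /= => wK; rewrite ltnNge wK.
Qed.

Lemma ev_agree g g' K q : all (valid K) q -> (forall k, (k < K)%N -> g k = g' k) ->
  ev g K q = ev g' K q.
Proof.
move=> /allP qv gg; apply/eq_in_map => t /qv/andP[tK mK].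
by rewrite (region_agree mK gg) gg.
Qed.

Lemma evS g K q : all (valid K) q ->
  ev g K.+1 q = avoid f (C (np (g K)).1) (ev g K q).
Proof.
move=> /allP qv; rewrite /avoid -map_comp; apply/eq_in_map => t /qv/andP[tK mK] /=.
congr pair; rewrite regionS //; apply/seteqP; split=> x.
  by move=> [? [? ?]].
by move=> [[? ?] ?].
Qed.

Definition nball g k := cb (nx (g k)) (nr (g k)).

(** Makes limits of nested balls lie in the G_delta sets: the ball of [K] enters the first open sets
    of every [nP] so far that contains its centre. *)
Definition diag g K := forall t, (t < K.+1)%N -> forall l, (l < K.+1)%N ->
  nP (g t) (nx (g K)) -> nball g K `<=` po (nP (g t)) l.

(* How node K arises from node k: inside its ball, as a child or sibling of the
   i-th entry t of its position chain, and in the l-th open set of A_t. *)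
Definition move_of g K k i l := nball g K `<=` nball g k /\
  forall t m c, drop i (pos g k) = (t, m) :: c ->
   [/\ nP (g K) `<=` nP (g t), nm (g K) = m,
       nc (g K) = (if inner then c else (t, m) :: c) &
       nball g K `<=` po (nA (g t)) l].

Definition good_move g K (v : nat * nat * nat) :=
  (v.1.1 < K)%N && (v.1.2 < size (pos g v.1.1))%N.

(** In [spec_move] the schedule is obeyed whenever its move is legal, so that every legal move is
    made at arbitrarily late stages. *)
Record node_spec g K : Prop := NodeSpec {
  spec_A : Pi0 2 (nA (g K));
  spec_P : Pi0 2 (nP (g K));
  spec_side : side (nA (g K)) (nP (g K)) (np (g K));
  spec_x : nP (g K) (nx (g K));
  spec_X0 : nP (g K) `<=` X0;
  spec_f : nP (g K) `<=` f @^-1` region g (nm (g K)) K;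
  spec_p : base_pair V (region g (nm (g K)) K) (np (g K));
  spec_c : all (valid K) (nc (g K));
  spec_m : okm K (nm (g K));
  spec_r : (K <= nr (g K))%N;
  spec_diag : diag g K;
  spec_0 : K = 0 -> nm (g K) = None /\ nc (g K) = [::];
  spec_move : (0 < K)%N -> exists v, [/\ good_move g K v,
    (good_move g K (sched K) -> v = sched K) & move_of g K v.1.1 v.1.2 v.2] }.

(** The kernel is that of stage [K], after the closures of all nodes so far have been removed: every
    centre stays a place where the tree can grow. *)
Definition inv K g := forall k, (k < K)%N ->
  node_spec g k /\ kernel I (ev g K (pos g k)) (nx (g k)).

Lemma pos_valid g K : node_spec g K -> all (valid K.+1) (pos g K).
Proof.
move=> S; have H : all (valid K.+1) (base g K).
  rewrite /= {1}/valid /= ltnSn /=; apply/andP; split.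
    by have := spec_m S; case: (nm _) => //= j; exact: ltnW.
  apply: sub_all (spec_c S) => t /andP[tK mK]; apply/andP; split; first exact: ltnW.
  by case: t.2 mK => //= j; exact: ltnW.
by rewrite /pos; case: inner => //=; rewrite {1}/valid /= !ltnSn.
Qed.

Lemma valid_leq K K' q : (K <= K')%N -> all (valid K) q -> all (valid K') q.
Proof.
move=> KK; apply: sub_all => t /andP[tK mK]; apply/andP; split.
  exact: leq_trans KK.
by case: t.2 mK => //= j jK; exact: leq_trans KK.
Qed.

(* The only place where the requirements of the earlier nodes are at stake. *)
Lemma new_node g K M cc m N : inv K g -> Sigma0 3 M -> ~ I M -> M `<=` X0 ->
  all (valid K) cc -> okm K m -> M `<=` kernel I (ev g K cc) ->
  M `<=` f @^-1` region g m K -> open N -> M `<=` N ->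
  exists n, let g' := extend g K n in
   [/\ nm n = m, nc n = cc, Pi0 2 (nA n), Pi0 2 (nP n) &
       side (nA n) (nP n) (np n)] /\
   [/\ nP n (nx n), nP n `<=` M, base_pair V (region g m K) (np n),
       (K <= nr n)%N & cb (nx n) (nr n) `<=` N] /\
   diag g' K /\
   forall k, (k < K.+1)%N -> kernel I (ev g' K.+1 (pos g' k)) (nx (g' k)).
Proof.
move=> gK [Pn Pn2 ME] nM MX0 ccv mK Mcc Mf oN MN.
have [i nPi] : exists i, ~ I (Pn i).
  apply: contrapT => /forallNP H; apply: nM; rewrite ME.
  by apply: (ideal_bigcup Is) => i; apply: contrapT; exact: H.
have PM : Pn i `<=` M by rewrite ME => x Px; exists i.
move: (Pn i) (Pn2 i : Pi0 2 (Pn i)) nPi PM => P P2 nIP PM {Pn Pn2 ME}.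
have PX0 := subset_trans PM MX0.
have [p [pO preq nS]] := step Ub f3 Is Sep0S Sep00 Sep0_open Sep0_ideal
  PX0 (Pi0_Sigma0S P2) nIP (subset_trans PM Mcc) (region_open g m K)
  (subset_trans PM Mf) (fun k kK => (gK k kK).2).
have [A [x [A2 AS Px Kx]]] := @newposP _ _ _ P2 PX0 nS.
(* [Pt] anticipates the [nP] of the extended sequence; [N'] collects the open conditions of
   [diag]. *)
pose Pt t := if t == K then P else nP (g t).
pose N' := N `&` [set z | forall t, (t < K.+1)%N -> [set z | forall l, (l < K.+1)%N ->
  [set z | Pt t x -> po (Pt t) l z] z] z].
have oN' : open N'.
  apply: openI => //; apply: open_forall_lt => t tK; apply: open_forall_lt => l lK.
  by apply: open_imply => _; exact: po_open.
have N'x : N' x.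
  split; first exact/MN/PM.
  move=> t tK l lK /= Ptx.
  have Pt2 : Pi0 2 (Pt t).
    rewrite /Pt; case: eqP => // /eqP tnK; apply: spec_P (gK t _).1.
    by rewrite ltn_neqAle tnK -ltnS.
  by move: Ptx; rewrite {1}(poE Pt2); apply.
have [r Kr rN'] := ball_small Bs K oN' N'x.
exists (Node A P p m cc x r) => g'.
have gg k : (k < K)%N -> g' k = g k by exact: extend_lt.
have gE : g' K = Node A P p m cc x r by exact: extend_eq.
split; first by split.
split; first by split=> // z /rN'[].
split.
  move=> t tK l lK; rewrite /nball gE /=.
  have -> : nP (g' t) = Pt t by rewrite /Pt /g' /extend; case: eqP.
  by move=> Ptx z /rN'[_ /(_ t tK l lK Ptx)].
have evE q : all (valid K) q -> ev g' K.+1 q = avoid f (C p.1) (ev g K q).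
  by move=> qv; rewrite evS // gE /= (ev_agree qv gg).
move=> k; rewrite ltnS leq_eqVlt => /orP[/eqP->|kK]; last first.
  have -> : pos g' k = pos g k by rewrite /pos /base gg.
  rewrite evE ?gg //; first exact: preq.
  exact: valid_leq kK (pos_valid (gK k kK).1).
suff -> : ev g' K.+1 (pos g' K) = newpos A P p ++ avoid f (C p.1) (ev g K cc).
  by rewrite gE.
have E1 : P `&` f @^-1` region g' m K.+1 = P `\` f @^-1` C p.1.
  rewrite regionS // gE /= -(region_agree mK (fun k kK => esym (gg k kK))).
  apply/seteqP; split=> z; first by move=> [Pz [_]].
  by move=> [Pz Cz]; split=> //; split=> //; exact/Mf/PM.
have E2 : region g' (Some K) K.+1 = V p.2 by rewrite region_new gE.
rewrite /pos /newpos /base gE -(evE cc ccv) /ev /=.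
by case: inner => /=; rewrite gE /= ?E1 ?E2.
Qed.

Lemma node_spec_local g g' k : (forall j, (j <= k)%N -> g' j = g j) ->
  (forall j, (j < k)%N -> node_spec g j) -> node_spec g k -> node_spec g' k.
Proof.
move=> gg gk [A2 P2 s Px PX0 Pf pO cv mv r dg z mo].
have fE m : okm k m -> region g' m k = region g m k.
  by move=> mk; apply: region_agree => // j jk; rewrite gg // ltnW.
split; rewrite ?gg ?fE //.
  by move=> t tk l lk; rewrite /nball !gg //; exact: dg.
move=> k0; have [v [gv sv mvv]] := mo k0; exists v.
have posE j : (j < k)%N -> pos g' j = pos g j.
  by move=> jk; rewrite /pos /base gg // ltnW.
have gmE w : good_move g' k w = good_move g k w.
  by rewrite /good_move; case: ltnP => //= wk; rewrite posE.
have /andP[vk vs] := gv.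
split; [by rewrite gmE|by rewrite gmE|].
case: mvv => bb mm; split; first by rewrite /nball !gg // ltnW.
move=> t m c; rewrite posE // => E.
have tk : (t < k)%N.
  have := valid_leq vk (pos_valid (gk v.1.1 vk)).
  rewrite -(cat_take_drop v.1.2 (pos g v.1.1)) E all_cat => /andP[_ /=].
  by move=> /andP[/andP[]].
by rewrite /nball !gg ?(ltnW tk) //; exact: mm.
Qed.

(** By [kernel_dense], points of A_t in the kernel come arbitrarily close to the centre of node k,
    so its ball meets the l-th open set of A_t in the kernel; by [kernel_positive] the part of P_t
    available there is outside the ideal. *)
Lemma next_node g K : Pi0 2 X0 -> ~ I X0 -> inv K g ->
  exists n, inv K.+1 (extend g K n).
Proof.
move=> X02 nX0 gK.
have local k n : (k < K)%N -> node_spec g k -> node_spec (extend g K n) k.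
  move=> kK; apply: node_spec_local => j jk; last exact: (gK j (ltn_trans jk kK)).1.
  by apply: extend_lt; exact: leq_ltn_trans kK.
have [K0|K0] := posnP K.
  subst K.
  have [] := @new_node g 0 X0 [::] None setT gK _ nX0.
  - exact: Pi0_Sigma0S.
  - by [].
  - by [].
  - by [].
  - by [].
  - by [].
  - exact: openT.
  - by [].
  move=> n [[nmE ncE A2 P2 sd] [[Px PM pO r _] [dg Kk]]].
  exists n => k kK; split; last exact: Kk.
  have -> : k = 0 by case: k kK.
  have gE : extend g 0 n 0 = n by exact: extend_eq.
  have fE m : okm 0 m -> region (extend g 0 n) m 0 = region g m 0.
    by move=> m0; exact: region_agree.
  split; rewrite ?gE ?nmE ?ncE ?fE //.
have [v [gv sv]] : exists v, good_move g K v /\ (good_move g K (sched K) -> v = sched K).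
  have [gs|ngs] := boolP (good_move g K (sched K)); first by exists (sched K).
  exists (0, 0, 0); split=> //; rewrite /good_move /= K0 /=.
  by rewrite /pos /base; case: inner.
have /andP[vK vs] := gv.
move: v gv sv vK vs => [[k i] l] gv sv /= kK ik.
have [gk Kk] := gK k kK.
case E : (drop i (pos g k)) => [|[t m] c].
  by move: (congr1 size E); rewrite size_drop => /eqP; rewrite subn_eq0 leqNgt ik.
have dv : all (valid K) (drop i (pos g k)).
  have := valid_leq kK (pos_valid gk).
  by rewrite -{1}(cat_take_drop i (pos g k)) all_cat => /andP[].
move: (dv); rewrite E => /= /andP[/andP[/= tK mK] cv].
have [gt _] := gK t tK.
have KE : kernel I (ev g K ((t, m) :: c)) (nx (g k)).
  by rewrite -E /ev map_drop; exact: (kernel_drop Is).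
have [w Aw [Kw Ow]] := kernel_dense Ub Is KE (ball_open Bs _ (nr (g k)))
  (ball_center Bs _ _).
pose N := ob (nx (g k)) (nr (g k)) `&` po (nA (g t)) l.
have oN : open N by apply: openI; [exact: ball_open Bs _ _|exact: po_open].
have Nw : N w.
  by split=> //; move: Aw; rewrite {1}(poE (spec_A gt)); apply.
pose M := nP (g t) `&` f @^-1` region g m K `&` kernel I (ev g K ((t, m) :: c)) `&` N.
have M3 : Sigma0 3 M.
  apply: Sigma0I; last exact: (open_Sigma03 Ub).
  apply: Sigma0I; last exact/(closed_Sigma03 Ub)/kernel_closed.
  by apply: Sigma0I; [exact/Pi0_Sigma0S/spec_P|apply: f3; exact: region_open].
have [] := @new_node g K M (if inner then c else (t, m) :: c) m N gK M3
  (kernel_positive Ub Is Kw oN Nw).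
- by move=> x [[[/(spec_X0 gt)]]].
- by case: inner => //=; rewrite cv andbT; apply/andP.
- by [].
- move=> x [[_ Kx] _]; case: inner => //; exact: (kernel_sub Is Kx).
- by move=> x [[[]]].
- by [].
- by move=> x [].
move=> n [[nmE ncE A2 P2 sd] [[Px PM pO r rN] [dg Kn]]].
exists n; set g' := extend g K n in dg Kn *.
have gE : g' K = n by exact: extend_eq.
have gg j : (j < K)%N -> g' j = g j by exact: extend_lt.
move=> j; rewrite ltnS leq_eqVlt => /orP[/eqP->|jK]; last first.
  by split; [exact: local (gK j jK).1|apply: Kn; exact: ltnW].
split; last exact: Kn.
have fE : region g' m K = region g m K.
  by rewrite (region_agree mK (fun j jK => esym (gg j jK))).
have gmE v : good_move g' K v = good_move g K v.
  by rewrite /good_move; case: ltnP => //= wk; rewrite /pos /base gg.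
split; rewrite ?gE ?nmE ?ncE ?fE //.
- by move=> x /PM[[[/(spec_X0 gt)]]].
- by move=> x /PM[[[]]].
- by case: inner => //=; rewrite cv andbT; apply/andP.
- by move=> K00; rewrite K00 in K0.
move=> _; exists (k, i, l); split; [by rewrite gmE|by rewrite gmE|].
split=> /=.
  by rewrite /nball gE gg // => z /rN[/(ball_sub Bs)].
move=> t' m' c'; rewrite /pos /base gg // -/(base g k) -/(pos g k) E => -[<- <- <-].
by split; rewrite ?gE ?gg // => x; [move=> /PM[[[]]]|rewrite /nball gE => /rN[]].
Qed.

Theorem construction : Pi0 2 X0 -> ~ I X0 ->
  exists g : nat -> node, forall K, node_spec g K.
Proof.
move=> X02 nX0.
have [x _] : exists x, X0 x.
  by apply: contrapT => /forallNP nE; apply: nX0; apply: (idealS Is) (ideal0 Is).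
have [||h hP] := @history_choice node (Node set0 set0 (0, 0) None [::] x 0) inv.
- by move=> k.
- by move=> K g; exact: next_node.
exists h => K; have [g gh gP] := hP K.+1.
apply: (@node_spec_local g) => [j jK|j jK|].
- by rewrite gh.
- by apply: (gP j _).1; rewrite ltnS ltnW.
- exact: (gP K _).1.
Qed.

End Construction.

Arguments node_spec {X Y} V f X0 cb po sched inner side g K.
Arguments move_of {X} cb po inner g K k i l.
Arguments nball {X} cb g k _.
Arguments region {X Y} V g m K _.
Arguments newpos {X Y} V f inner A P p.

(** * Branches and generic points *)

Lemma dependent_sequence (A : Type) (P : A -> Prop) (R : nat -> A -> A -> Prop) a0 :
  P a0 -> (forall l a, P a -> exists2 b, P b & R l a b) ->
  exists2 s : nat -> A, s 0 = a0 & forall l, P (s l) /\ R l (s l) (s l.+1).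
Proof.
move=> P0 PR.
have /choice[F FP] : forall p : nat * A, exists b, P p.2 -> P b /\ R p.1 p.2 b.
  move=> [l a]; have [Pa|nPa] := pselect (P a); last by exists a.
  by have [b Pb Rb] := PR l a Pa; exists b.
pose s := fix s l := if l is l'.+1 then F (l', s l') else a0.
have Ps l : P (s l) by elim: l => [|l IH] //=; exact: (FP (l, s l) IH).1.
by exists s => // l; split=> //; exact: (FP (l, s l) (Ps l)).2.
Qed.

Lemma increasing_ge (k : nat -> nat) : (forall i, (k i < k i.+1)%N) ->
  forall i, (i <= k i)%N.
Proof. by move=> kk; elim=> // i IH; exact: leq_ltn_trans IH (kk i). Qed.

Lemma increasing_leq (k : nat -> nat) : (forall i, (k i < k i.+1)%N) ->
  forall i j, (i <= j)%N -> (k i <= k j)%N.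
Proof.
move=> kk i; elim=> [|j IH]; first by rewrite leqn0 => /eqP->.
rewrite leq_eqVlt => /orP[/eqP->//|]; rewrite ltnS => /IH H.
exact: leq_trans H (ltnW (kk j)).
Qed.

Section Tree.
Context {X Y : topologicalType} {V : nat -> set Y} (f : X -> Y) (X0 : set X).
Context {ob cb : X -> nat -> set X} (Bs : ball_structure ob cb).
Context {po : set X -> nat -> set X} (po_open : forall A l, open (po A l)).
Hypothesis poE : forall A, Pi0 2 A -> A = \bigcap_l po A l.
Context (sched : nat -> nat * nat * nat) (inner : bool).
Hypothesis schedP : forall v N, exists2 K, (N <= K)%N & sched K = v.
Context (side : set X -> set X -> nat * nat -> Prop).
Context (h : nat -> node X).
Hypothesis hS : forall K, node_spec V f X0 cb po sched inner side h K.

Lemma posE k :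
  pos inner h k = (if inner then [:: (k, Some k)] else [::]) ++ base h k.
Proof. by rewrite /pos; case: inner. Qed.

Notation base := (base h).
Notation pos := (pos inner h).
Notation nball := (nball cb h).

(* For [inner = true] only chains of inner steps count: an outer sibling of j is
   not a descendant of j. *)
Definition desc j k := exists i, drop i (base k) = base j.

Lemma desc_refl k : desc k k. Proof. by exists 0; rewrite drop0. Qed.

Lemma desc_trans i j k : desc i j -> desc j k -> desc i k.
Proof. by move=> [a E1] [b E2]; exists (a + b)%N; rewrite -drop_drop E2. Qed.

Lemma base_cons k : base k = (k, nm (h k)) :: nc (h k).
Proof. by []. Qed.

Lemma parent k : (0 < k)%N -> exists k' i t m c, [/\ (k' < k)%N,
  drop i (pos k') = (t, m) :: c, nc (h k) = drop i (base k'),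
  nm (h k) = m & nP (h k) `<=` nP (h t) /\ nball k `<=` nball k'].
Proof.
move=> k0; have [[[k' i] l] [/andP[/= kk ik] _ [/= bk mk]]] := spec_move (hS k) k0.
case E : (drop i (pos k')) => [|[t m] c].
  by move: (congr1 size E); rewrite size_drop => /eqP; rewrite subn_eq0 leqNgt ik.
have [Pt mE cE _] := mk _ _ _ E; exists k', i, t, m, c; split=> //.
rewrite cE; move: E; rewrite posE; case: inner => /= [E|->//].
by have := congr1 behead E; rewrite -drop1 drop_drop add1n /= => ->.
Qed.

(** The chain of a node is a tail of the [base] of an earlier one, so by induction every nonempty
    tail of a [base] is again a [base]. *)
Lemma drop_base k i t m c : drop i (base k) = (t, m) :: c -> base t = (t, m) :: c.
Proof.
elim/ltn_ind: k i t m c => k IH [|i] t m c.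
  by rewrite drop0 base_cons => -[<- <- <-].
have [->|k0] := posnP k; first by rewrite /= (spec_0 (hS 0) erefl).2; case: i.
have [k' [j [t' [m' [c' [kk _ cE _ _]]]]]] := parent k0.
by rewrite /= cE drop_drop; exact: IH.
Qed.

Lemma desc_sub j k : desc j k ->
  [/\ (j <= k)%N, nball k `<=` nball j & nP (h k) `<=` nP (h j)].
Proof.
elim/ltn_ind: k j => k IH j [[|i]]; first by rewrite drop0 !base_cons => -[-> _ _]; split.
have [->|k0] := posnP k; first by rewrite /= (spec_0 (hS 0) erefl).2; case: i.
have [k' [i' [t [m [c [kk E cE mE [Pt bk]]]]]]] := parent k0.
rewrite /= cE drop_drop => jE.
have jk' : desc j k' by exists (i + i')%N.
have [jk bj Pj] := IH _ kk _ jk'.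
split; [exact/ltnW/(leq_ltn_trans jk)|exact: subset_trans bj|].
apply: subset_trans Pt _.
have tk : desc t k' /\ (desc j t \/ t = k').
  move: E; rewrite posE; case: inner => /=; last first.
    move=> E; have tE := drop_base E; split; first by exists i'; rewrite E tE.
    by left; exists i; rewrite tE -E drop_drop.
  case: i' jE {cE} => [|i'] jE.
    by rewrite drop0 => -[<- _ _]; split; [exact: desc_refl|right].
  move=> /= E; have tE := drop_base E; split; first by exists i'; rewrite E tE.
  by left; exists i.+1; rewrite tE -E drop_drop addSnnS.
have [tk' [jt|->//]] := tk; have [tk'' _ _] := IH _ kk _ tk'.
by have [] := IH t (leq_ltn_trans tk'' kk) j jt.
Qed.

Lemma desc_pos j k : desc j k -> exists2 i, (i < size (pos k))%N &
  drop i (pos k) = (j, nm (h j)) :: nc (h j).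
Proof.
(* The coercion of [inner] to 0 or 1 skips the inner entry of [pos]. *)
move=> [i E]; exists (inner + i)%N.
  rewrite ltnNge; apply/negP => /drop_oversize; rewrite posE.
  by case: inner => /=; rewrite ?drop0 E.
by rewrite posE; case: inner => /=; rewrite ?drop0 E.
Qed.

Lemma spawn k i l N : (i < size (pos k))%N ->
  exists2 K, (N <= K)%N /\ (k < K)%N & move_of cb po inner h K k i l.
Proof.
move=> ik; have [K KN sK] := schedP (k, i, l) (maxn N k.+1).
move: KN; rewrite geq_max => /andP[NK kK]; exists K => //.
have [v [_ sv mv]] := spec_move (hS K) (leq_ltn_trans (leq0n k) kK).
by have vE : v = (k, i, l); [rewrite -sK; apply: sv; rewrite sK; exact/andP|
  move: mv; rewrite vE].
Qed.

Lemma limit_point (k : nat -> nat) : (forall i, (k i < k i.+1)%N) ->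
  (forall i, nball (k i.+1) `<=` nball (k i)) ->
  exists z, [/\ forall i, nball (k i) z,
    forall O, open O -> O z -> exists i, nball (k i) `<=` O &
    (forall i, nP (h (k i.+1)) `<=` nP (h (k i))) -> forall i, nP (h (k i)) z].
Proof.
move=> kk bk.
have [] := @ball_nested _ _ _ Bs (fun i => nx (h (k i))) (fun i => nr (h (k i))) _ bk.
  by move=> i; exact: leq_trans (increasing_ge kk i) (spec_r (hS _)).
move=> z zb zO; exists z; split=> // Pk i; rewrite (poE (spec_P (hS (k i)))) => l _.
have Pij j : (i <= j)%N -> nP (h (k j)) `<=` nP (h (k i)).
  elim: j => [|j IH]; first by rewrite leqn0 => /eqP->.
  rewrite leq_eqVlt => /orP[/eqP->//|]; rewrite ltnS => /IH.
  exact: subset_trans (Pk j).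
(* Late enough for [diag] to treat both node [k i] and its open set of index [l]. *)
pose j := maxn i l.
have ij : (i <= j)%N by exact: leq_maxl.
apply: (spec_diag (hS (k j)) (t := k i) _ (l := l)) => //.
- by rewrite ltnS; exact: increasing_leq.
- by rewrite ltnS; apply: leq_trans (increasing_ge kk j); exact: leq_maxr.
- exact/(Pij j ij)/spec_x.
Qed.

Lemma spawn_outer j k l N : desc j k -> exists K,
  [/\ (N <= K)%N /\ (k < K)%N, nm (h K) = nm (h j),
      nc (h K) = (if inner then nc (h j) else base j),
      nP (h K) `<=` nP (h j) &
      nball K `<=` nball k /\ nball K `<=` po (nA (h j)) l].
Proof.
move=> /desc_pos[i ik E]; have [K NK [bK mK]] := spawn l N ik.
by have [PK nmK ncK pK] := mK _ _ _ E; exists K; split.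
Qed.

Lemma spawn_inner k : inner -> exists K,
  [/\ (k < K)%N, nm (h K) = Some k, nc (h K) = base k,
      nP (h K) `<=` nP (h k) & nball K `<=` nball k].
Proof.
move=> inner1; have ik : (0 < size (pos k))%N by rewrite posE inner1.
have [K [_ kK] [bK mK]] := spawn 0 0 ik.
have E : drop 0 (pos k) = (k, Some k) :: base k by rewrite drop0 posE inner1.
by have [PK nmK ncK _] := mK _ _ _ E; exists K; split=> //; rewrite ncK inner1.
Qed.

(** An inner child of [j] descends from it; an outer sibling inherits both the label and the
    chain. *)
Lemma region_desc j k : inner -> nm (h k) = Some j -> desc j k.
Proof.
move=> inner1; elim/ltn_ind: k j => k IH j.
have [->|k0] := posnP k; first by rewrite (spec_0 (hS 0) erefl).1.
have [k' [i [t [m [c [kk E cE -> _]]]]]] := parent k0.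
move: E; rewrite posE inner1 => + mj; case: i cE => [|i] cE /=.
  move=> -[_ km _]; move: mj; rewrite -km => -[<-].
  by exists 1; rewrite /= drop0 cE drop0.
move=> E; have tE := drop_base E.
have tk : (t < k)%N.
  have : desc t k' by exists i; rewrite E tE.
  by case/desc_sub => tk' _ _; exact: leq_ltn_trans kk.
have nmt : nm (h t) = Some j by move: tE; rewrite base_cons => -[-> _].
(* A zero offset would make [t] equal to [j], although the label of [t] is an earlier node; a
   positive one runs through the chain that [k] shares with [t]. *)
have [[|a] aE] := IH t tk j nmt.
  have := spec_m (hS t); rewrite nmt /=.
  by move: aE; rewrite drop0 !base_cons => -[-> _ _]; rewrite ltnn.
have ncE : nc (h k) = nc (h t).
  rewrite cE -add1n -drop_drop E /= drop0.
  by move: tE; rewrite base_cons => -[].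
by exists a.+1; rewrite /= ncE; exact: aE.
Qed.

Lemma region_None k : ~~ inner -> nm (h k) = None.
Proof.
move=> inner0; elim/ltn_ind: k => k IH.
have [->|k0] := posnP k; first exact: (spec_0 (hS 0) erefl).1.
have [k' [i [t [m [c [kk E cE mE _]]]]]] := parent k0.
move: E; rewrite posE (negbTE inner0) /= => E; have tE := drop_base E.
rewrite mE; have : desc t k' by exists i; rewrite E tE.
case/desc_sub => tk' _ _; have := IH t (leq_ltn_trans tk' kk).
by move: tE; rewrite base_cons => -[-> _].
Qed.

(** For [inner], the last clause forces a branch into the open set of each of its nodes. *)
Definition link a b := [/\ (a < b)%N, desc a b &
  inner -> nP (h b) `<=` f @^-1` V (np (h a)).2].

Definition branch j z := exists k : nat -> nat, [/\ k 0 = j,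
  forall i, link (k i) (k i.+1), forall i, nP (h (k i)) z &
  forall O, open O -> O z -> exists i, nball (k i) `<=` O].

Hypothesis link_exists : forall a, exists b, link a b.

(** Baire category: otherwise, for each [m] in turn, a link and a descent lead to a node whose
    branches miss [H m], and the branch so obtained lies in no [H m]. *)
Lemma nonmeager_piece (H : nat -> set X) :
  (forall z, branch 0 z -> exists m, H m z) ->
  exists m j, forall k, desc j k -> exists2 z, H m z & branch k z.
Proof.
move=> Hz; apply: contrapT => nH.
have nH' m j : exists2 k, desc j k & forall z, H m z -> ~ branch k z.
  apply: contrapT => nE; apply: nH; exists m, j => k jk; apply: contrapT => nz.
  by apply: nE; exists k => // z Hmz bz; apply: nz; exists z.
have [k k0 kP] : exists2 k : nat -> nat, k 0 = 0 & forall m,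
    link (k m) (k m.+1) /\ forall z, H m z -> ~ branch (k m.+1) z.
  have [//|m a _|k k0 kP] := @dependent_sequence nat (fun=> True)
      (fun m a b => link a b /\ forall z, H m z -> ~ branch b z) 0.
    have [b [ab adb aP]] := link_exists a; have [c bc ncz] := nH' m b.
    have [bc' _ Pbc] := desc_sub bc.
    exists c => //; split=> //; split.
    - exact: leq_trans bc'.
    - exact: desc_trans bc.
    - by move=> /aP; exact: subset_trans.
  by exists k => // m; have [_] := kP m.
have kl i : link (k i) (k i.+1) by have [] := kP i.
have [z [zb zO zP]] := @limit_point k (fun i => let: And3 h1 _ _ := kl i in h1)
  (fun i => let: And3 _ h2 _ := kl i in let: And3 _ g2 _ := desc_sub h2 in g2).
have Pz i : nP (h (k i)) z.
  by apply: zP => {}i; have [_ /desc_sub[]] := kl i.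
have [m Hm] : exists m, H m z by apply: Hz; exists k; split.
have [_ nb] := kP m; apply: (nb z Hm).
(* The tail is a branch starting at [k m.+1], a node chosen to miss [H m]. *)
exists (fun i => k (m.+1 + i)%N); split=> //.
- by rewrite addn0.
- by move=> i; rewrite addnS; exact: kl.
move=> O oO Oz; have [i iO] := zO O oO Oz; exists i.
apply: subset_trans iO; elim: (m.+1) => // n IH; rewrite addSn.
by apply: subset_trans IH; have [_ /desc_sub[]] := kl (n + i)%N.
Qed.

(** Branches through [H] lead into the next open set of [H], then a child of [j] grown there enters
    the next open set of [nA (h j)]; the limit is in both G_delta sets. *)
Lemma piece_outer (H : set X) j : Pi0 2 H ->
  (forall k, desc j k -> exists2 z, H z & branch k z) -> ~~ inner ->
  exists2 z, H z & nA (h j) z.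
Proof.
move=> H2 Hj inner0.
have [|l a ja|k k0 kP] := @dependent_sequence nat (desc j) (fun l a b =>
    [/\ (a < b)%N, nball b `<=` nball a, nball b `<=` po H l &
        nball b `<=` po (nA (h j)) l]) j.
- exact: desc_refl.
- have [z Hz [k [k0 kl _ kO]]] := Hj a ja.
  have [i iO] : exists i, nball (k i) `<=` po H l.
    by apply: kO => //; move: Hz; rewrite {1}(poE H2); apply.
  have [ak bk] : (a <= k i)%N /\ desc a (k i) /\ nball (k i) `<=` nball a.
    elim: i {iO} => [|i [IH1 [IH2 IH3]]]; first by rewrite k0; do !split=> //; exact: desc_refl.
    have [kk dk _] := kl i; have [_ bk _] := desc_sub dk.
    split; first exact/(leq_trans IH1)/ltnW.
    by split; [exact: desc_trans dk|exact: subset_trans IH3].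
  have [K [[aK kK] _ cK _ [bK AK]]] := spawn_outer l a.+1 (desc_trans ja bk.1).
  exists K; last first.
    split=> //; first exact: subset_trans bk.2.
    exact: subset_trans iO.
  by exists 1; rewrite /= drop0 cK (negbTE inner0).
have [z [zb _ _]] := @limit_point k (fun i => let: conj _ (And4 h1 _ _ _) := kP i in h1)
    (fun i => let: conj _ (And4 _ h2 _ _) := kP i in h2).
exists z.
  by rewrite (poE H2) => l _; have [_ [_ _ + _]] := kP l; apply.
by rewrite (poE (spec_A (hS j))) => l _; have [_ [_ _ _]] := kP l; apply.
Qed.

(* Alternate between points of H and outer siblings of a first inner child. *)
Lemma piece_inner (H : set X) j : Pi0 2 H ->
  (forall k, desc j k -> exists2 z, H z & branch k z) -> inner ->
  exists2 z, H z & forall N, exists v, [/\ (N <= v)%N, nm (h v) = Some j & nP (h v) z].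
Proof.
move=> H2 Hj inner1; have [a [ja na _ _ _]] := spawn_inner j inner1.
have [//|l v nv|k k0 kP] := @dependent_sequence nat (fun v => nm (h v) = Some j)
  (fun l a b => [/\ (a < b)%N, nball b `<=` nball a, nball b `<=` po H l &
        nP (h b) `<=` nP (h a)]) a.
- have [z Hz [k [k0 kl _ kO]]] := Hj v (region_desc inner1 nv).
  have [i iO] : exists i, nball (k i) `<=` po H l.
    by apply: kO => //; move: Hz; rewrite {1}(poE H2); apply.
  have bk : desc v (k i) /\ nball (k i) `<=` nball v.
    elim: i {iO} => [|i [IH2 IH3]]; first by rewrite k0; split=> //; exact: desc_refl.
    have [kk dk _] := kl i; have [_ bk _] := desc_sub dk.
    by split; [exact: desc_trans dk|exact: subset_trans IH3].
  have [K [[vK kK] mK _ PK [bK _]]] := spawn_outer l v.+1 bk.1.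
  exists K; first by rewrite mK.
  split=> //; first exact: subset_trans bk.2.
  exact: subset_trans iO.
have [z [zb _ zP]] := @limit_point k (fun i => let: conj _ (And4 h1 _ _ _) := kP i in h1)
    (fun i => let: conj _ (And4 _ h2 _ _) := kP i in h2).
exists z.
  by rewrite (poE H2) => l _; have [_ [_ _ + _]] := kP l; apply.
move=> N; exists (k N); split.
- by apply: increasing_ge => i; have [_ []] := kP i.
- by have [] := kP N.
- by apply: zP => i; have [_ []] := kP i.
Qed.

End Tree.

Arguments link {X Y} V f inner h a b.

(** * Metric spaces *)

Section Metric.
Context {R : realType} {T : topologicalType} (d : T -> T -> R).
Hypothesis dT : compatible_metric d.

Local Open Scope ring_scope.

Lemma dist_xx x : d x x = 0. Proof. by case: dT => -[_ + _ _] _ => /(_ x x)[_ ->]. Qed.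
Lemma dist_sym x y : d x y = d y x. Proof. by case: dT => -[]. Qed.
Lemma dist_triangle x y z : d x z <= d x y + d y z. Proof. by case: dT => -[]. Qed.

Lemma dist_open (A : set T) : open A <->
  forall x, A x -> exists2 e : R, 0 < e & [set y | d x y < e] `<=` A.
Proof. by case: dT. Qed.

Lemma open_dist_ball x (e : R) : open [set y | d x y < e].
Proof.
apply/dist_open => y /= dxy; exists (e - d x y); first by rewrite subr_gt0.
move=> z /= dyz; have := dist_triangle x y z; lra.
Qed.

Lemma closed_dist_ball x (e : R) : closed [set y | d x y <= e].
Proof.
rewrite -openC; apply/dist_open => y /= /negP; rewrite -ltNge => dxy.
exists (d x y - e); first by rewrite subr_gt0.
move=> z /= dyz; apply/negP; rewrite -ltNge.
have := dist_triangle x z y; rewrite (dist_sym z y); lra.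
Qed.

Lemma invS_small (e : R) K : 0 < e -> exists2 n, (K <= n)%N & n.+1%:R^-1 < e.
Proof.
move=> e0; exists (maxn K (Num.bound e^-1)); first exact: leq_maxl.
rewrite invf_plt ?posrE ?ltr0n//.
apply: lt_le_trans (_ : (Num.bound e^-1)%:R <= _).
  by apply: archi_boundP; rewrite invr_ge0 ltW.
by rewrite ler_nat ltnW // ltnS leq_maxr.
Qed.

Lemma metric_regular_base : separable T -> exists U : nat -> set T, regular_base U.
Proof.
move=> [D /countable_injP[g ginj] dD].
pose B a n := [set y | exists2 x, D x & g x = a /\ d x y < n.+1%:R^-1].
exists (fun k => if @unpickle (nat * nat)%type k is Some (a, n) then B a n else set0).
have BE a n x : D x -> g x = a -> B a n = [set y | d x y < n.+1%:R^-1].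
  move=> Dx gx; apply/seteqP; split=> y /=; last by exists x.
  by move=> [x' Dx' [gx']]; rewrite (ginj x' x) ?inE // gx'.
have Bo a n : open (B a n).
  have [[x [Dx gx]]|nx] := pselect (exists x, D x /\ g x = a).
    by rewrite (BE _ _ _ Dx gx); exact: open_dist_ball.
  rewrite (_ : B a n = set0); first exact: open0.
  by apply/seteqP; split=> // y [x Dx [gx _]]; apply: nx; exists x.
split.
  by move=> i; case: unpickle => [[a n]|]; [exact: Bo|exact: open0].
move=> O x oO Ox; have [e e0 eO] := (dist_open O).1 oO x Ox.
(* The centre is within one radius of [x] and the closed ball adds another, whence e / 2. *)
have [n _ ne] := @invS_small (e / 2) 0 ltac:(lra).
have n0 : 0 < n.+1%:R^-1 :> R by rewrite invr_gt0.
have xx : [set y | d x y < n.+1%:R^-1] !=set0 by exists x; rewrite /= dist_xx.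
have [z [dz Dz]] := dD _ xx (open_dist_ball x _).
exists (pickle (g z, n)); rewrite pickleK (BE _ _ z) //=.
  by rewrite dist_sym.
have zc : [set y | d z y < n.+1%:R^-1] `<=` [set y | d z y <= n.+1%:R^-1].
  by move=> y /= /ltW.
move=> y /(closureS zc); rewrite -(closure_id _).1; last exact: closed_dist_ball.
move=> /= dzy; apply: eO => /=; have := dist_triangle x z y.
by move: dz ne dzy => /=; move: (n.+1%:R^-1 : R) => r; lra.
Qed.

Lemma metric_ball_structure : complete_metric d ->
  ball_structure (fun x n => [set y | d x y < n.+1%:R^-1])
    (fun x n => [set y | d x y <= n.+1%:R^-1]).
Proof.
move=> dC; split.
- by move=> x n; exact: open_dist_ball.
- by move=> x n /=; rewrite dist_xx invr_gt0.
- by move=> x n y /= /ltW.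
- move=> O x K oO Ox; have [e e0 eO] := (dist_open O).1 oO x Ox.
  have [n Kn ne] := invS_small K e0; exists n => // y /= dxy; apply: eO => /=.
  exact: le_lt_trans ne.
- move=> x n nn sub.
  have xc i j : (i <= j)%N -> d (x i) (x j) <= (n i).+1%:R^-1.
    move=> ij; suff sub_ij : [set y | d (x j) y <= (n j).+1%:R^-1] `<=`
        [set y | d (x i) y <= (n i).+1%:R^-1].
      by apply: sub_ij; rewrite /= dist_xx invr_ge0.
    elim: j ij => [|j IH]; first by rewrite leqn0 => /eqP->.
    rewrite leq_eqVlt => /orP[/eqP->//|]; rewrite ltnS => /IH.
    exact: subset_trans (sub j).
  have inv_le i N : (N <= i)%N -> (n i).+1%:R^-1 <= N.+1%:R^-1 :> R.
    move=> Ni; rewrite lef_pV2 ?posrE ?ltr0n// ler_nat ltnS.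
    exact: leq_trans (nn i).
  have [l xl] : exists l : T, x @ \oo --> l.
    apply: dC => e e0; have [N _ Ne] := @invS_small (e / 2) 0 ltac:(lra).
    exists N => i j Ni Nj; have := dist_triangle (x i) (x N) (x j).
    rewrite (dist_sym (x i) (x N)); have := xc _ _ Ni; have := xc _ _ Nj.
    have := inv_le N N (leqnn N); move: Ne.
    by move: (N.+1%:R^-1 : R) ((n N).+1%:R^-1 : R) => r r'; lra.
  have lb i : d (x i) l <= (n i).+1%:R^-1.
    apply: (@closed_cvg _ _ \oo _ x [set y | d (x i) y <= (n i).+1%:R^-1]) => //.
      exact: closed_dist_ball.
    by exists i => // j /= ij; exact: xc.
  exists l => //.
  move=> O oO Ol; have [e e0 eO] := (dist_open O).1 oO l Ol.
  have [N _ Ne] := @invS_small (e / 2) 0 ltac:(lra).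
  exists N => y /= dy; apply: eO => /=; have := dist_triangle l (x N) y.
  rewrite (dist_sym l (x N)); have := lb N; have := inv_le N N (leqnn N).
  move: Ne dy => /=.
  by move: (N.+1%:R^-1 : R) ((n N).+1%:R^-1 : R) => r r'; lra.
Qed.

End Metric.

(** * Non-decomposable functions *)

Section Hard_directions.
Context {X Y : topologicalType} {U : nat -> set X} (Ub : regular_base U).
Context {V : nat -> set Y} (Vb : regular_base V) (f : X -> Y).
Context {ob cb : X -> nat -> set X} (Bs : ball_structure ob cb).

Lemma open_codes : exists2 po : set X -> nat -> set X,
  forall A l, open (po A l) & forall A, Pi0 2 A -> A = \bigcap_l po A l.
Proof.
have /choice[po poP] : forall A : set X, exists O : nat -> set X,
    (forall l, open (O l)) /\ (Pi0 2 A -> A = \bigcap_l O l).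
  move=> A; have [/Pi02P[O Oo AE]|nA] := pselect (Pi0 2 A); first by exists O.
  by exists (fun=> setT); split=> // l; exact: openT.
by exists po => A; [move=> l; exact: (poP A).1|exact: (poP A).2].
Qed.

Lemma region_disjoint (h : nat -> node X) u w :
  (forall k, closure (V (np (h k)).1) `<=` region V h None k) ->
  (u < w)%N -> V (np (h u)).1 `&` V (np (h w)).1 = set0.
Proof.
move=> hp uw; apply/seteqP; split=> // y [yu yw].
by have [_ /(_ u uw isT)] := hp w _ (subset_closure yw); apply; exact: subset_closure.
Qed.

Lemma dec_ideal2_of_preimage :
  (forall A : set Y, Sigma0 2 A -> Sigma0 3 (f @^-1` A)) -> dec_ideal f 2 setT.
Proof.
move=> f2; apply: contrapT => nX.
set I := dec_ideal f 2 in nX; have Is : sigma_ideal I := dec_ideal_sigma f 1.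
have f3 W : open W -> Sigma0 3 (f @^-1` W).
  by move=> oW; apply: f2; exact: (open_Sigma02 Vb oW).
have [po po_open poE] := open_codes.
have [sched schedP] := schedule_exists (0, 0, 0).
(* Generic points of a node are to be mapped into its inner open set, hence into [E]. *)
pose side (A P : set X) (p : nat * nat) := A `<=` P `&` f @^-1` V p.2.
have newposP P p c : Pi0 2 P -> P `<=` setT ->
    ~ Sep2 I ((P `&` f @^-1` V p.2) `&` kernel I c)
            ((P `\` f @^-1` closure (V p.1)) `&` kernel I c) ->
    exists A x, [/\ Pi0 2 A, side A P p, P x &
      kernel I (newpos V f false A P p ++ c) x].
  move=> P2 _ nS.
  (* This trace is only Sigma_3; one of its G_delta pieces stays inseparable and becomes [A]. *)
  have [An An2 AE] : Sigma0 3 (P `&` f @^-1` V p.2).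
    by apply: Sigma0I; [exact: Pi0_Sigma0S|exact/f3/Vb.1].
  have [n nSn] : exists n, ~ Sep2 I (An n `&` kernel I c)
      ((P `\` f @^-1` closure (V p.1)) `&` kernel I c).
    apply: contrapT => /forallNP S; apply: nS; rewrite AE setI_bigcupl.
    by apply: (Sep2_bigcup Is) => n; apply: contrapT; exact: S.
  have [x Ax Kx] := kernel_nonempty Ub Is nSn.
  have AP : An n `<=` P `&` f @^-1` V p.2 by rewrite AE => z ?; exists n.
  by exists (An n), x; split=> //; [exact: An2|have [] := AP _ Ax].
have Sep20 B : Sep2 I set0 B by exact: (Sep2_empty Is).
have [h hS] := construction Ub Vb f3 Is (@Sep2S _ _ Is) Sep20 (Sep2_open Ub Is)
  (fun P O _ => @Sep2_ideal _ _ _ Vb f P O) Bs po_open poE sched newposP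
  (open_Pi02 openT) nX.
have nN k : nm (h k) = None := region_None hS k isT.
have hp k : closure (V (np (h k)).1) `<=` region V h None k.
  by have [+ _] := spec_p (hS k); rewrite nN.
(* E is relatively closed in the union of the disjoint open sets V_(p_u).1. *)
pose E := [set y | exists u, closure (V (np (h u)).2) y].
have nE2 : Sigma0 2 (~` E).
  have -> : ~` E = ~` (\bigcup_u V (np (h u)).1) `|`
      \bigcup_u (V (np (h u)).1 `&` ~` closure (V (np (h u)).2)).
    apply/seteqP; split=> y.
      move=> nEy; have [[u _ Vy]|nV] := pselect ((\bigcup_u V (np (h u)).1) y).
        by right; exists u => //; split=> // Cy; apply: nEy; exists u.
      by left.
    have sub w : closure (V (np (h w)).2) `<=` V (np (h w)).1.
      by have [] := spec_p (hS w).
    move=> [nV [u /sub Vu]|[u _ [Vu nC]] [w Cw]]; first by apply: nV; exists u.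
    have [uw|wu|uw] := ltngtP u w.
    - have : (V (np (h u)).1 `&` V (np (h w)).1) y by split=> //; exact: sub.
      by rewrite (region_disjoint hp uw).
    - have : (V (np (h w)).1 `&` V (np (h u)).1) y by split=> //; exact: sub.
      by rewrite (region_disjoint hp wu).
    - by apply: nC; rewrite uw.
  apply: Sigma0U.
    by apply/closed_Sigma02/open_closedC/bigcup_open => u _; exact: Vb.1.
  apply: Sigma0_bigcup => u; apply: (open_Sigma02 Vb); apply: openI; first exact: Vb.1.
  exact/closed_openC/closed_closure.
have [H H2 HE] := f2 _ nE2.
have link_ex a : exists b, link V f false h a b.
  have [K [[_ aK] _ cK _ _]] := spawn_outer schedP hS 0 0 (desc_refl h a).
  by exists K; split=> //; exists 1; rewrite /= drop0 cK.
have [z bz|m [j Hj]] := nonmeager_piece Bs poE hS link_ex (H := H).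
  have [k [k0 kl Pk _]] := bz.
  suff : (f @^-1` (~` E)) z by rewrite HE => -[m _ Hm]; exists m.
  (* Node [k u.+1] has index above [u], so its values avoid the closure claimed by node [u], which
     contains the closure of the inner open set. *)
  move=> [u Cu].
  have kk i : (k i < k i.+1)%N by have [] := kl i.
  have [_] := spec_f (hS (k u.+1)) (Pk u.+1).
  rewrite nN; move/(_ u (increasing_ge kk u.+1) isT); apply.
  by apply: subset_closure; have [_] := spec_p (hS u); apply.
have [z Hz Az] := piece_outer Bs po_open poE schedP hS (H2 m) Hj isT.
have : (f @^-1` (~` E)) z by rewrite HE; exists m.
apply; exists j; apply: subset_closure.
by have [] := spec_side (hS j) z Az.
Qed.

Lemma dec_ideal1_of_preimage X0 : Pi0 2 X0 -> measurable_on f 2 X0 ->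
  (forall A : set Y, Sigma0 3 A -> Sigma0 3 (f @^-1` A)) -> dec_ideal f 1 X0.
Proof.
move=> X02 m0 fS; apply: contrapT => nX.
set I := dec_ideal f 1 in nX; have Is : sigma_ideal I := dec_ideal_sigma f 0.
have f3 W : open W -> Sigma0 3 (f @^-1` W).
  by move=> oW; apply: fS; exact: (open_Sigma03 Vb oW).
have [po po_open poE] := open_codes.
have [sched schedP] := schedule_exists (0, 0, 0).
pose side (A P : set X) (p : nat * nat) := True.
have newposP P p c : Pi0 2 P -> P `<=` X0 ->
    ~ Sep1 I ((P `&` f @^-1` V p.2) `&` kernel I c)
            ((P `\` f @^-1` closure (V p.1)) `&` kernel I c) ->
    exists A x, [/\ Pi0 2 A, side A P p, P x &
      kernel I (newpos V f true A P p ++ c) x].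
  (* With [A] the whole space, the complement of [K1] is open and null on [B]; so [A0] is not null
     on [K1], or that complement would separate. *)
  move=> P2 _ nS; exists setT.
  set B := P `\` _ in nS; pose K1 := kernel I ((setT, B) :: c).
  set A0 := P `&` _ in nS.
  have nI : ~ I (A0 `&` K1).
    move=> IA; apply: nS; exists (~` K1); split.
    - exact/closed_openC/kernel_closed.
    - by apply: (idealS Is) IA => x [[Ax _] /contrapT].
    - by apply: (idealS Is) (kernelT_null Ub Is B c) => x [].
  have [x [[Px _] _] Kx] : exists2 x, (A0 `&` K1) x &
      kernel I ((setT, A0) :: (setT, B) :: c) x.
    apply: contrapT => nE; apply: nI.
    apply: (idealS Is) (kernelT_null Ub Is A0 ((setT, B) :: c)) => x Ax; split=> // Kx.
    by apply: nE; exists x.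
  by exists x; split=> //; exact/open_Pi02/openT.
have Sep10 B : Sep1 I set0 B.
  by exists set0; split; rewrite ?set0I ?set0D; [exact: open0|exact: (ideal0 Is)..].
have [h hS] := construction Ub Vb f3 Is (Sep1S Is) Sep10
  (Sep1_open Is) (fun P O => @Sep1_ideal _ _ _ Ub _ Vb f X0 P O m0) Bs po_open poE
  sched newposP X02 nX.
have inner_sub a b : nm (h b) = Some a -> nP (h b) `<=` f @^-1` V (np (h a)).2.
  by move=> nb x /(spec_f (hS b)); rewrite nb => -[].
pose E := [set y | forall k, exists2 u, (k <= u)%N & V (np (h u)).2 y].
have E3 : Sigma0 3 E.
  apply: Pi0_Sigma0S.
  have -> : E = \bigcap_k \bigcup_(u in [set u | (k <= u)%N]) V (np (h u)).2.
    apply/seteqP; split=> y Ey k; first by move=> _; have [u ku Vu] := Ey k; exists u.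
    by have [u ku Vu] := Ey k Logic.I; exists u.
  by apply: Pi0_bigcap => k; apply: open_Pi02; apply: bigcup_open => u _; exact: Vb.1.
have [H H2 HE] := fS _ E3.
have link_ex a : exists b, link V f true h a b.
  have [K [aK nK cK _ _]] := spawn_inner schedP hS a isT.
  exists K; split=> //; first by exists 1; rewrite /= drop0 cK.
  by move=> _; exact: inner_sub.
have [z bz|m [j Hj]] := nonmeager_piece Bs poE hS link_ex (H := H).
  have [k [k0 kl Pk _]] := bz.
  suff : (f @^-1` E) z by rewrite HE => -[m _ Hm]; exists m.
  have kk i : (k i < k i.+1)%N by have [] := kl i.
  move=> i; exists (k i); first exact: increasing_ge.
  by have [_ _ /(_ isT)] := kl i; apply; exact: Pk.
have [z Hz Pz] := piece_inner Bs po_open poE schedP hS (H2 m) Hj isT.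
have : (f @^-1` E) z by rewrite HE; exists m.
(* f z lies in the region of [j] at arbitrarily late stages, so it avoids the closures of all nodes
   after [j], contrary to lying in [E]. *)
move=> /(_ j.+1)[u ju Vu]; have [v [uv nv Pv]] := Pz u.+1.
have [_ ] := spec_f (hS v) Pv; rewrite nv => /(_ u uv ju); apply.
apply: subset_closure; have [_ H1] := spec_p (hS u).
by apply: H1; exact: subset_closure.
Qed.

End Hard_directions.

(** * Decompositions *)

Section Dec.
Context {X Y : topologicalType} (f : X -> Y).

Lemma Sigma0_subspace n (N : set X) (W : set (set_type N)) : Sigma0 n.+1 W <->
  exists2 S, Sigma0 n.+1 S & W = set_val @^-1` S.
Proof.
elim: n W => [|n IH] W.
  by split=> [[S oS <-]|[S oS ->]]; exists S.
split=> [[F FS ->]|[S [F FS ->] ->]].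
  have /choice[S SP] : forall i, exists S, Sigma0 n.+1 S /\ ~` F i = set_val @^-1` S.
    by move=> i; have [S S1 SE] := (IH _).1 (FS i); exists S.
  exists (\bigcup_i ~` S i).
    by apply: Sigma0S_bigcup => i; apply/Pi0C; exact: (SP i).1.
  rewrite preimage_bigcup; apply: eq_bigcupr => i _.
  by rewrite -preimage_setC -(SP i).2 setCK.
rewrite preimage_bigcup; apply: Sigma0S_bigcup => i.
by apply/IH; exists (~` F i) => //; exact: FS.
Qed.

Lemma measurable_onE n N : measurable_on f n.+1 N <-> Sigma0_measurable n.+1 (sigL N f).
Proof.
split=> fN W oW.
  have [S S1 SE] := fN W oW; apply/Sigma0_subspace; exists S => //.
  apply/seteqP; split=> -[x xN] /=; rewrite set_valE /= => Wx.
    have : (f @^-1` W `&` N) x := conj Wx (set_mem xN).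
    by rewrite SE => -[].
  have : (S `&` N) x := conj Wx (set_mem xN).
  by rewrite -SE => -[].
have [S S1 SE] := (Sigma0_subspace _ _).1 (fN W oW); exists S => //.
have SX x (xN : x \in N) : W (f x) <-> S x.
  have : (sigL N f @^-1` W) (exist _ x xN) = (set_val @^-1` S) (exist _ x xN).
    by rewrite SE.
  by rewrite /= set_valE /= => ->.
by apply/seteqP; split=> x [Wx Nx]; split=> //; apply/(SX x (mem_set Nx)).
Qed.

Context {U : nat -> set X} (Ub : regular_base U).

(** A Sigma_3 piece splits into G_delta ones. Conversely G_delta sets are Delta_3, and subtracting
    the earlier ones makes them disjoint. *)
Lemma decE n : dec n.+1 3 f <-> dec_ideal f n.+1 setT.
Proof.
have Is := dec_ideal_sigma f n.
split.
  move=> [Z [_ ZT ZD Zm]]; rewrite -ZT; apply: (ideal_bigcup Is) => k.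
  have [[F F2 ZE] _] := ZD k; rewrite ZE; apply: (ideal_bigcup Is) => i.
  apply: dec_ideal_Pi02; first exact: F2.
  apply: measurable_onS ((measurable_onE n (Z k)).2 (Zm k)).
  by rewrite ZE => x Fx; exists i.
move=> [N NP NT].
pose D := fix D k := if k is k'.+1 then D k' `|` N k' else set0.
have N3 k : Sigma0 3 (N k) /\ Pi0 3 (N k).
  have [N2 _] := NP k; split; first exact: Pi0_Sigma0S.
  exact: (Sigma02_Sigma03 Ub).
have D3 k : Sigma0 3 (D k) /\ Pi0 3 (D k).
  elim: k => [|k [IH1 IH2]].
    split; first exact: (Sigma0_0T 2).1.
    rewrite (_ : D 0 = ~` setT); last by rewrite setCT.
    by apply/Pi0C; exact: (Sigma0_0T 2).2.
  by have [? ?] := N3 k; split; [exact: (@Sigma0U _ 2)|exact: (@Pi0U _ 2)].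
have Dlt i j : (i < j)%N -> N i `<=` D j.
  elim: j => // j IH; rewrite ltnS leq_eqVlt => /orP[/eqP->|/IH H] x Nx.
    by right.
  by left; exact: H.
exists (fun k => N k `\` D k); split.
- apply/trivIsetP => i j _ _ ij; apply/seteqP; split=> // x [[Ni nDi] [Nj nDj]].
  by move: ij; rewrite neq_ltn => /orP[/Dlt/(_ x Ni)|/Dlt/(_ x Nj)].
- apply/seteqP; split=> // x _; have [k _ Nk] := NT x Logic.I.
  have [m Nm mmin] := @ex_minnP (fun k => `[< N k x >]) (ex_intro _ k (asboolT Nk)).
  exists m => //; split; first exact/asboolP.
  have : forall j, (j <= m)%N -> ~ D j x.
    elim=> [_ []|j IH jm [|Nj]]; first exact: IH (ltnW jm).
    by have /mmin := asboolT Nj; rewrite leqNgt jm.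
  by move=> /(_ m (leqnn m)).
- move=> k; have [? ?] := N3 k; have [? ?] := D3 k; split.
    by apply: Sigma0I => //; exact/Pi0C.
  by apply: Pi0I => //; exact/Pi0C.
- move=> k; apply/measurable_onE; apply: measurable_onS (NP k).2.
  by move=> x [].
Qed.

Lemma preimage_of_pieces m (A : set Y) (N : nat -> set X) (F : nat -> set Y) :
  [set: X] `<=` \bigcup_k N k -> A = \bigcup_i F i ->
  (forall i k, Sigma0 m.+1 (f @^-1` F i `&` N k)) -> Sigma0 m.+1 (f @^-1` A).
Proof.
move=> NT -> FN.
have -> : f @^-1` (\bigcup_i F i) = \bigcup_(p : nat * nat) (f @^-1` F p.1 `&` N p.2).
  apply/seteqP; split=> x.
    by move=> [i _ Fx]; have [k _ Nx] := NT x Logic.I; exists (i, k).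
  by move=> [[i k] _ [Fx _]]; exists i.
exact: Sigma0_bigcup.
Qed.

(** On a G_delta piece where f is Sigma_2-measurable, closed sets pull back to G_delta sets. *)
Lemma dec_ideal2_preimage A : dec_ideal f 2 setT -> Sigma0 2 A ->
  Sigma0 3 (f @^-1` A).
Proof.
move=> [N NP NT] [F Fo AE]; apply: (preimage_of_pieces NT AE) => i k.
have [N2 Nm] := NP k; have [S S2 SE] := Nm _ (Fo i).
apply: Pi0_Sigma0S.
have -> : f @^-1` F i `&` N k = ~` S `&` N k.
  apply/seteqP; split=> x [Fx Nx]; split=> //.
    by move=> Sx; have : (S `&` N k) x by []; rewrite -SE => -[].
  by apply: contrapT => nF; have : (f @^-1` (~` F i) `&` N k) x by []; rewrite SE => -[].
by apply: Pi0I => //; exact/Pi0C.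
Qed.

Lemma dec_ideal1_preimage A : dec_ideal f 1 setT -> Sigma0 3 A ->
  Sigma0 3 (f @^-1` A).
Proof.
move=> [N NP NT] [F F2 AE]; apply: (preimage_of_pieces NT AE) => i k.
have [N2 Nm] := NP k; have [O Oo FE] := (Pi02P (F i)).1 (F2 i).
apply: Pi0_Sigma0S; rewrite FE.
have /choice[S SP] : forall j, exists S, open S /\ f @^-1` O j `&` N k = S `&` N k.
  by move=> j; have [S oS SE] := Nm _ (Oo j); exists S.
have -> : f @^-1` (\bigcap_j O j) `&` N k = (\bigcap_j S j) `&` N k.
  apply/seteqP; split=> x [H Nx]; split=> // j _.
    have : (f @^-1` O j `&` N k) x := conj (H j Logic.I) Nx.
    by rewrite (SP j).2 => -[].
  have : (S j `&` N k) x := conj (H j Logic.I) Nx.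
  by rewrite -(SP j).2 => -[].
apply: Pi0I => //; apply: Pi0_bigcap => j; apply: open_Pi02; exact: (SP j).1.
Qed.

End Dec.

(** * Both equivalences for Polish X and separable metrizable Y *)

Unset Implicit Arguments.

Theorem theorem1p2 (R : realType) (X Y : topologicalType) (f : X -> Y)
    (hX : polish R X) (hYs : separable Y) (hYm : metrizable R Y) :
  ((forall A : set Y, Sigma0 2 A -> Sigma0 3 (f @^-1` A)) <-> dec 2 3 f) /\
  ((forall A : set Y, Sigma0 3 A -> Sigma0 3 (f @^-1` A)) <-> dec 1 3 f).
Proof.
have [sX [dX dXc dXcomplete]] := hX; have [dY dYc] := hYm.
have [U Ub] := metric_regular_base dXc sX.
have [V Vb] := metric_regular_base dYc hYs.
have Bs := metric_ball_structure dXc dXcomplete.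
have dec2 := dec_ideal2_of_preimage Ub Vb (f := f) Bs.
split; split.
- by move=> /dec2 f2; exact/(decE f Ub).
- by move=> /(decE f Ub) f2 A; exact: dec_ideal2_preimage.
- move=> fS; apply/(decE f Ub).
  (* By (i), X is covered by G_delta pieces on which f is Sigma_2-measurable, and (ii) is proved on
     each of them. *)
  have [N NP NT] := dec2 (fun A A2 => fS A (Sigma02_Sigma03 Vb A2)).
  apply: (idealS (dec_ideal_sigma f 0) NT).
  apply: (ideal_bigcup (dec_ideal_sigma f 0)) => k.
  exact: (dec_ideal1_of_preimage Ub Vb Bs (NP k).1 (NP k).2 fS).
- by move=> /(decE f Ub) f1 A; exact: dec_ideal1_preimage.
Qed.
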